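(* For every $\varepsilon\in(0,1)$ and integer $d\ge 2$ there is $C_0$ such that for every $C\ge C_0$ the following holds. For every $n$, let $T$ be a tree on at most $(1-\varepsilon)n$ vertices with maximum degree $d$, let $G$ be a pseudorandom graph on $n$ vertices, and write $p:=C/n$. Suppose that $G_p$ is uniformly edge-coloured with $n$ colours. Then, with probability tending to $1$ as $n\to\infty$, $G_p$ contains a rainbow copy of $T$.
   Context: A graph $G$ on $n$ vertices is pseudorandom if for any two disjoint vertex subsets $A,B$ with $|A|\cdot|B|\ge 250n$ we have $e_G(A,B)\ge |A||B|/3$, where $e_G(A,B)$ is the number of edges of $G$ with one end in $A$ and the other in $B$. For $p\in[0,1]$, $G_p$ is the random subgraph of $G$ obtained by keeping each edge independently with probability $p$. Uniformly edge-coloured with $n$ colours: each edge independently gets a uniformly random colour from a fixed set of $n$ colours. Rainbow: all edges have distinct colours. *)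

(* Defs.v *)
From HB Require Import structures.
From mathcomp Require Import all_boot all_order all_algebra.
From mathcomp Require Import reals.

Set Implicit Arguments.
Unset Strict Implicit.
Unset Printing Implicit Defensive.

Import Order.TTheory GRing.Theory Num.Theory.

Local Open Scope nat_scope.

Record sgraph := SGraph {
  vertex :> finType;
  adj : rel vertex;
  adj_sym : symmetric adj;
  adj_irr : irreflexive adj }.

Definition edges (G : sgraph) : {set {set G}} :=
  [set e : {set G} | [exists x, exists y, adj x y && (e == [set x; y])]].

Definition degree (G : sgraph) (x : G) : nat := #|[set y | adj x y]|.

Definition max_degree (G : sgraph) : nat := \max_(x : G) degree x.

Definition graph_connected (G : sgraph) : Prop :=
  0 < #|G| /\ forall x y : G, connect (@adj G) x y.

(* [ucycle] accepts a single edge traversed back and forth as a cycle on two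
   vertices, so genuine cycles are those on at least three vertices. *)
Definition graph_acyclic (G : sgraph) : Prop :=
  forall s : seq G, ucycle (@adj G) s -> size s < 3.

Definition is_tree (G : sgraph) : Prop := graph_connected G /\ graph_acyclic G.

Definition edges_between (G : sgraph) (A B : {set G}) : nat :=
  #|[set e in edges G | [exists x in A, exists y in B, e == [set x; y]]]|.

Definition pseudorandom (G : sgraph) : Prop :=
  forall A B : {set G}, [disjoint A & B] ->
    250 * #|G| <= #|A| * #|B| ->
    #|A| * #|B| <= 3 * edges_between A B.

(* A spanning subgraph of a graph on V is represented by its edge set H.  An
   edge-colouring is a function on all subsets of V, of which only the values
   at the edges of H are ever used. *)

Definition rainbow (V K : finType) (c : {ffun {set V} -> K})
    (F : {set {set V}}) : bool :=
  [forall e1 in F, forall e2 in F, (c e1 == c e2) ==> (e1 == e2)].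

Definition copy_edges (T : sgraph) (V : finType) (f : {ffun T -> V}) :
  {set {set V}} := [set [set f x | x in e] | e : {set T} in edges T].

Definition has_rainbow_copy (T : sgraph) (V K : finType) (H : {set {set V}})
    (c : {ffun {set V} -> K}) : bool :=
  [exists f : {ffun T -> V},
    [&& injectiveb f, copy_edges f \subset H & rainbow c (copy_edges f)]].

Local Open Scope ring_scope.

(* The law of the pair (G_p, colouring): G_p = H with probability
   p^e(H) (1-p)^(e(G)-e(H)) for each H included in E(G), and the colouring is
   drawn independently and uniformly among all functions, that is, with
   independent uniform values; its restriction to H is therefore a uniform
   edge-colouring of H. *)
Definition coloured_Gp_prob (R : realType) (G : sgraph) (p : R) (K : finType)
    (Q : {set {set G}} -> {ffun {set G} -> K} -> bool) : R :=
  \sum_(H : {set {set G}} | H \subset edges G)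
    p ^+ #|H| * (1 - p) ^+ #|edges G :\: H| *
    (#|[set c | Q H c]|%:R / #|{ffun {set G} -> K}|%:R).

(* Main.v *)
Require Import Defs.
From HB Require Import structures.
From mathcomp Require Import all_boot all_order all_algebra.
From mathcomp Require Import boolp reals zify lra.

(** Cut T, rooted, into boundedly many connected pieces of small linear size and
    reserve a block of vertices of G, slightly larger than the piece, for each of
    them.  Inside one block G_p has far fewer edges than there are unused colours,
    so keeping one edge for each unused colour that occurs yields a rainbow graph
    in which, with overwhelming probability, any two large sets of vertices are
    joined by an edge.  The Friedman-Pippenger argument embeds the piece there,
    with its root at any vertex outside a small exceptional set.

    A piece is attached to the part embedded before by a single edge, which is
    found only with constant probability.  Therefore a large constant number of
    partial embeddings is carried along, whose attachment vertices are pairwise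
    distinct, so that the edges leaving them are independent: of every large
    batch of these embeddings one can almost surely be extended. *)

Set Implicit Arguments.
Unset Strict Implicit.
Unset Printing Implicit Defensive.

Import Order.TTheory GRing.Theory Num.Theory.

(** * Rooted trees *)

Local Open Scope nat_scope.

Lemma set2_inj (V : finType) (x y x' y' : V) : [set x; y] = [set x'; y'] ->
  (x = x' /\ y = y') \/ (x = y' /\ y = x').
Proof.
move=> E; have /set2P x_in : x \in [set x'; y'] by rewrite -E set21.
have /set2P y_in : y \in [set x'; y'] by rewrite -E set22.
have /set2P x'_in : x' \in [set x; y] by rewrite E set21.
have /set2P y'_in : y' \in [set x; y] by rewrite E set22.
intuition congruence.
Qed.

Lemma mem_edges (G : sgraph) (x y : G) : ([set x; y] \in edges G) = adj x y.
Proof.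
rewrite inE; apply/existsP/idP => [[u /existsP[v /andP[auv /eqP/set2_inj]]]|axy].
  by case=> -[-> ->] //; rewrite adj_sym.
by exists x; apply/existsP; exists y; rewrite axy eqxx.
Qed.

Lemma leq_card_bigcup (I T : finType) (P : pred I) (F : I -> {set T}) :
  #|\bigcup_(i | P i) F i| <= \sum_(i | P i) #|F i|.
Proof.
elim/big_rec2: _ => [|i m A _ IH]; first by rewrite cards0.
by rewrite (leq_trans (leq_card_setU _ _)) // leq_add2l.
Qed.

Lemma leq_card_setD (T : finType) (A B : {set T}) : #|A| <= #|A :\: B| + #|B|.
Proof. by rewrite -(cardsID B A) addnC leq_add2l subset_leq_card ?subsetIr. Qed.

Record rooted_tree (T : finType) := RootedTree {
  tree_root : T;
  parent : T -> T;
  depth : T -> nat;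
  parent_root : parent tree_root = tree_root;
  depth_parent : forall v, v != tree_root -> depth (parent v) < depth v }.

Section RootedTree.
Variables (T : finType) (S : rooted_tree T).
Local Notation root := (tree_root S).

Definition children (v : T) : {set T} := [set w | (w != root) && (parent S w == v)].

Definition descendants (v : T) : {set T} := [set w | fconnect (parent S) w v].

Lemma parent_ind (Q : T -> Prop) :
  Q root -> (forall v, v != root -> Q (parent S v) -> Q v) -> forall v, Q v.
Proof.
move=> Qroot Qstep v; have [n] := ubnP (depth S v).
elim: n v => // n IH v; rewrite ltnS => vn.
have [->//|vr] := eqVneq v root; apply: Qstep => //; apply: IH.
exact: leq_trans (depth_parent vr) vn.
Qed.

Lemma connect_rooted (e : rel T) : connect_sym e ->
  (forall v, v != root -> e v (parent S v)) -> forall x y, connect e x y.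
Proof.
move=> e_sym e_parent x y.
have to_root v : connect e v root.
  elim/parent_ind: v => [|v vr]; first exact: connect0.
  exact: connect_trans (connect1 (e_parent v vr)).
by rewrite (connect_trans (to_root x)) // e_sym.
Qed.

Lemma depth_descendant v w : w \in descendants v -> depth S v <= depth S w.
Proof.
rewrite inE => /iter_findex <-; elim: (findex _ _ _) => //= k IH.
apply: leq_trans IH; have [->|ne] := eqVneq (iter k (parent S) w) root.
  by rewrite parent_root.
exact: ltnW (depth_parent ne).
Qed.

Lemma descendant_refl v : v \in descendants v.
Proof. by rewrite inE connect0. Qed.

Lemma descendant_of_parent v w : parent S w \in descendants v -> w \in descendants v.
Proof. by rewrite !inE; apply: connect_trans; apply: fconnect1. Qed.

Lemma parent_descendant v w : w \in descendants v -> w != v ->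
  parent S w \in descendants v.
Proof.
rewrite !inE => /iter_findex; case: (findex _ _ _) => [/= ->|k]; first by rewrite eqxx.
by rewrite iterSr => <- _; apply: fconnect_iter.
Qed.

Lemma parent_notin_descendants v : v != root -> parent S v \notin descendants v.
Proof.
by move=> vr; apply/negP=> /depth_descendant; rewrite leqNgt (depth_parent vr).
Qed.

Lemma root_notin_descendants v : v != root -> root \notin descendants v.
Proof.
move=> vr; rewrite inE; apply/negP=> /iter_findex E; case/eqP: vr; rewrite -E.
by elim: (findex _ _ _) => //= k ->; apply: parent_root.
Qed.

Lemma descendants_sub v :
  descendants v \subset v |: \bigcup_(c in children v) descendants c.
Proof.
apply/subsetP=> w; elim/parent_ind: w => [|w wr IH] wd.
  by apply/setU1P; left; apply: contraTeq wd => vr;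
    rewrite root_notin_descendants // eq_sym.
have [->|wv] := eqVneq w v; first by rewrite setU11.
apply/setU1P; right; apply/bigcupP.
have /setU1P[pv|/bigcupP[c cv pc]] := IH (parent_descendant wd wv).
  by exists w; rewrite ?descendant_refl // inE wr pv eqxx.
by exists c => //; apply: descendant_of_parent.
Qed.

End RootedTree.

Lemma connected_rooting (T : sgraph) : graph_connected T ->
  exists S : rooted_tree T, forall v, v != tree_root S -> adj (parent S v) v.
Proof.
case=> /card_gt0P[r _] conn.
pose reach v k := [exists p : k.-tuple T, path (@adj T) r p && (last r p == v)].
have reachP v : exists k, reach v k.
  case/connectP: (conn r v) => p pp ->; exists (size p).
  by apply/existsP; exists (in_tuple p); rewrite pp eqxx.
pose dist v := ex_minn (reachP v).
have closer v : v != r -> exists u, adj u v && (dist u < dist v).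
  rewrite /dist; case: (ex_minnP (reachP v))
    => -[|k] /existsP[[p /= /eqP sp] /andP[pp /eqP lp]] _.
    by case: p sp lp {pp} => //= _ ->; rewrite eqxx.
  case/lastP: p sp pp lp => // p w; rewrite size_rcons => -[sp].
  rewrite rcons_path last_rcons => /andP[pp aw] <- _; exists (last r p).
  rewrite aw ltnS; case: ex_minnP => m _ -> //.
  by apply/existsP; exists (Tuple (introT eqP sp)); rewrite /= pp eqxx.
pose par v := if v == r then r else odflt r [pick u | adj u v && (dist u < dist v)].
have parP v : v != r -> adj (par v) v && (dist (par v) < dist v).
  move=> vr; rewrite /par (negPf vr); case: pickP => //= none.
  by have [u] := closer v vr; rewrite none.
have par_r : par r = r by rewrite /par eqxx.
have par_closer v (vr : v != r) := proj2 (andP (parP v vr)).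
by exists (RootedTree par_r par_closer) => v /parP/andP[].
Qed.

Lemma acyclic_edge_bridge (T : sgraph) (x y : T) : graph_acyclic T -> adj x y ->
  ~~ connect [rel u v | adj u v && ([set u; v] != [set x; y])] x y.
Proof.
move=> acyc axy; apply/negP=> /connectP[p /shortenP[q pq uq _] {p} yE].
have long : 1 < size q.
  case: q pq yE {uq} => [_ yE|z [|//] /= + yE]; first by rewrite yE adj_irr in axy.
  by rewrite -yE eqxx !andbF.
have /acyc : ucycle (@adj T) (x :: q); last by rewrite /= ltnS ltnNge long.
apply/andP; split=> //=; rewrite rcons_path -yE adj_sym axy andbT.
by apply: sub_path pq => u v /andP[].
Qed.

Lemma tree_rooting (T : sgraph) : is_tree T -> exists S : rooted_tree T,
  forall x y : T, adj x y = (x \in children S y) || (y \in children S x).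
Proof.
case=> /connected_rooting[S adj_parent] acyc; exists S => x y.
have adj_child u v : u \in children S v -> adj v u.
  by rewrite inE => /andP[ur /eqP<-]; apply: adj_parent.
apply/idP/orP=> [axy|[/adj_child|/adj_child//]]; last by rewrite adj_sym.
apply/orP; apply: contraT => /norP[xNy yNx].
have /negP[] := acyclic_edge_bridge acyc axy.
apply: (connect_rooted (S := S)) => [|v vr].
  by apply: sym_connect_sym => u v; rewrite /= adj_sym setUC.
rewrite /= adj_sym adj_parent //=; apply/eqP=> /set2_inj[[vx py]|[vy px]].
- by case/negP: xNy; rewrite inE -vx vr py eqxx.
- by case/negP: yNx; rewrite inE -vy vr px eqxx.
Qed.

(* Piece 0, the trunk, is what has not been cut off yet.  The pieces are numbered
   in such a way that each of them hangs from a piece with a smaller number. *)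
Record cutting (T : finType) (S : rooted_tree T) := Cutting {
  pieces : nat;
  piece_of : T -> nat;
  piece_top : nat -> T;
  piece_of_le : forall v, piece_of v <= pieces;
  piece_of_root : piece_of (tree_root S) = 0;
  piece_of_parent_trunk : forall v, piece_of v = 0 -> piece_of (parent S v) = 0;
  piece_of_top : forall j, 0 < j <= pieces -> piece_of (piece_top j) = j;
  piece_of_parent_top : forall j, 0 < j <= pieces ->
    piece_of (parent S (piece_top j)) < j;
  piece_of_parent : forall v, 0 < piece_of v -> v != piece_top (piece_of v) ->
    piece_of (parent S v) = piece_of v }.

Definition piece (T : finType) (S : rooted_tree T) (c : cutting S) (j : nat) : {set T} :=
  [set v | piece_of c v == j].

Section Cutting.
Variables (T : finType) (S : rooted_tree T).
Implicit Types c : cutting S.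
Local Notation root := (tree_root S).

Lemma mem_piece c j v : (v \in piece c j) = (piece_of c v == j).
Proof. by rewrite inE. Qed.

Lemma piece_of_parent_le c v : piece_of c (parent S v) <= piece_of c v.
Proof.
have [v0|v_gt0] := posnP (piece_of c v); first by rewrite piece_of_parent_trunk.
have [E|ne] := eqVneq v (piece_top c (piece_of c v)).
  by rewrite {1}E ltnW // piece_of_parent_top // v_gt0 piece_of_le.
by rewrite piece_of_parent.
Qed.

Lemma sum_card_piece c : \sum_(j < (pieces c).+1) #|piece c j| = #|T|.
Proof.
rewrite -sum1_card.
rewrite (partition_big (fun v => @inord (pieces c) (piece_of c v)) xpredT) //=.
apply: eq_bigr => j _; rewrite -sum1_card; apply: eq_bigl => v.
by rewrite mem_piece -val_eqE /= inordK // ltnS piece_of_le.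
Qed.

Definition branch c (v : T) : {set T} := piece c 0 :&: descendants S v.

Lemma branch_out_trunk c v : v \notin piece c 0 -> branch c v = set0.
Proof.
apply: contraNeq => /set0Pn[w /setIP[]]; rewrite !mem_piece => /eqP w0.
rewrite inE => /iter_findex <-; elim: (findex _ _ _) => [|k /eqP IH];
  first by rewrite w0.
by rewrite /= piece_of_parent_trunk.
Qed.

Lemma mem_branch_self c v : v \in piece c 0 -> v \in branch c v.
Proof. by move=> v0; rewrite inE v0 descendant_refl. Qed.

Lemma cut_branch c v : v \in piece c 0 -> v != root ->
  exists c', [/\ pieces c' = (pieces c).+1, piece c' 0 = piece c 0 :\: branch c v,
    piece c' 1 = branch c v & forall j, piece c' j.+2 = piece c j.+1].
Proof.
move=> v0 vr; pose shift k := if k is k'.+1 then k'.+2 else 0.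
pose piece_of' w := if w \in branch c v then 1 else shift (piece_of c w).
pose top' j := if j is j'.+2 then piece_top c j'.+1 else v.
have off_trunk w k : piece_of c w = k.+1 -> piece_of' w = k.+2.
  by move=> wk; rewrite /piece_of' inE mem_piece wk.
have le' w : piece_of' w <= (pieces c).+1.
  by rewrite /piece_of'; case: ifP => // _; have := piece_of_le c w; case: piece_of.
have root' : piece_of' root = 0.
  by rewrite /piece_of' inE (negPf (root_notin_descendants vr)) andbF piece_of_root.
have parent_trunk' w : piece_of' w = 0 -> piece_of' (parent S w) = 0.
  rewrite /piece_of'; case: ifPn => // wB; case wE: (piece_of c w) => // _.
  rewrite piece_of_parent_trunk // ifN //; apply: contra wB => /setIP[_ pd].
  by rewrite inE mem_piece wE eqxx descendant_of_parent.
have of_top' j : 0 < j <= (pieces c).+1 -> piece_of' (top' j) = j.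
  case: j => [//|[|j]] js /=; first by rewrite /piece_of' mem_branch_self.
  by apply: off_trunk; rewrite piece_of_top.
have parent_top' j : 0 < j <= (pieces c).+1 -> piece_of' (parent S (top' j)) < j.
  case: j => [//|[|j]] js /=; rewrite /piece_of'.
    rewrite ifN; first by rewrite piece_of_parent_trunk //; apply/eqP;
      rewrite -mem_piece.
    by rewrite inE negb_and (parent_notin_descendants vr) orbT.
  by case: ifP => // _; have := piece_of_parent_top (c := c) (j := j.+1) js;
    case: piece_of.
have of_parent' w : 0 < piece_of' w -> w != top' (piece_of' w) ->
    piece_of' (parent S w) = piece_of' w.
  rewrite {1 2 4}/piece_of'; case: ifPn => [wB _ /= wv|_].
    have /setIP[] := wB; rewrite mem_piece => /eqP w0 wd.
    by rewrite /piece_of' ifT // inE mem_piece piece_of_parent_trunk // parent_descendant.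
  case wE: (piece_of c w) => [//|k] _ /= wt; apply: off_trunk.
  by rewrite piece_of_parent wE.
exists (Cutting le' root' parent_trunk' of_top' parent_top' of_parent').
split=> // [|| j]; apply/setP=> w; rewrite ?in_setD !mem_piece /= /piece_of'.
- by case: ifP => //= _; case: (piece_of c w).
- by case: ifP => //= _; case: (piece_of c w) => [|[]].
case: ifP => [/setIP[+ _]|_]; first by rewrite mem_piece => /eqP->.
by case: (piece_of c w).
Qed.

Section BoundedDegree.
Variables (d t : nat).
Hypothesis children_le : forall v, #|children S v| <= d.
Hypotheses (d_gt0 : 0 < d) (t_gt0 : 0 < t).

Lemma card_branch_le c v :
  (forall w, w \in children S v -> #|branch c w| < t) -> #|branch c v| <= d * t.
Proof.
move=> light; have sub : branch c v \subset v |: \bigcup_(w in children S v) branch c w.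
  apply/subsetP=> u /setIP[u0 ud].
  have /setU1P[->|/bigcupP[w wv uw]] := subsetP (descendants_sub S v) u ud.
    exact: setU11.
  by apply/setU1P; right; apply/bigcupP; exists w; rewrite // in_setI u0.
apply: leq_trans (subset_leq_card sub) _.
rewrite (leq_trans (leq_card_setU _ _)) // cards1.
apply: (@leq_trans (1 + \sum_(w in children S v) t.-1)).
  rewrite leq_add2l; apply: leq_trans (leq_card_bigcup _ _) _.
  by apply: leq_sum => w wv; rewrite -ltnS prednK ?light.
rewrite sum_nat_const; apply: (@leq_trans (d + d * t.-1)).
  by rewrite leq_add // leq_mul2r children_le orbT.
by rewrite -mulnS prednK.
Qed.

Lemma light_branch c : piece c 0 != [set root] ->
  exists v, [/\ v \in piece c 0, v != root, #|branch c v| <= d * t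
    & (t <= #|branch c v|) || (parent S v == root)].
Proof.
move=> trunk_big.
have [v0 v0_trunk v0r] : exists2 v, v \in piece c 0 & v != root.
  have : ~~ (piece c 0 \subset [set root]).
    apply: contra trunk_big => sA.
    by rewrite eqEsubset sA sub1set mem_piece piece_of_root eqxx.
  by case/subsetPn=> v v0; rewrite inE => vr; exists v.
have [heavy|all_light] :=
    pickP [pred v | [&& v \in piece c 0, v != root & t <= #|branch c v|]].
  move=> heavy_ok.
  have [v /and3P[v_trunk vr vt] v_max] := arg_maxnP (depth S) heavy_ok.
  exists v; split; rewrite ?vt //; apply: card_branch_le => w.
  rewrite inE => /andP[wr /eqP wv]; rewrite ltnNge; apply/negP=> tw.
  have w_trunk : w \in piece c 0.
    by apply: contraLR tw => /branch_out_trunk->; rewrite cards0 -ltnNge.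
  have /v_max : [&& w \in piece c 0, w != root & t <= #|branch c w|] by apply/and3P.
  by rewrite /geq /= leqNgt -wv depth_parent.
have v0_ok : (v0 \in piece c 0) && (v0 != root) by rewrite v0_trunk.
have [v /andP[v_trunk vr] v_min] :=
  @arg_minnP _ v0 (fun v => (v \in piece c 0) && (v != root)) (depth S) v0_ok.
have light : #|branch c v| < t.
  by have := all_light v; rewrite /= v_trunk vr /= ltnNge => ->.
exists v; split; rewrite // ?(leq_trans (ltnW light)) ?leq_pmull //.
apply/orP; right; apply: contraT => pr.
have /v_min : (parent S v \in piece c 0) && (parent S v != root).
  by rewrite pr andbT; move: v_trunk; rewrite !mem_piece
    => /eqP/piece_of_parent_trunk->.
by rewrite leqNgt depth_parent.
Qed.

Definition light_pieces c : Prop := forall j, 0 < j <= pieces c ->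
  #|piece c j| <= d * t.

(* Each cut either removes at least t vertices from the trunk or a child of the root. *)
Definition few_pieces c : Prop :=
  pieces c * t + #|piece c 0| + t * #|children S root :&: piece c 0|
    <= #|T| + t * #|children S root|.

Lemma few_pieces_cut c c' v : v \in piece c 0 -> v != root ->
  (t <= #|branch c v|) || (parent S v == root) ->
  pieces c' = (pieces c).+1 -> piece c' 0 = piece c 0 :\: branch c v ->
  few_pieces c -> few_pieces c'.
Proof.
move=> v0 vr v_ok cs' trunk'; rewrite /few_pieces cs' trunk'.
have : #|piece c 0 :\: branch c v| + #|branch c v| = #|piece c 0|.
  by rewrite cardsDS ?subsetIl // subnK // subset_leq_card ?subsetIl.
have sub :
    children S root :&: (piece c 0 :\: branch c v) \subset children S root :&: piece c 0.
  by rewrite setIS ?subsetDl.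
case/orP: v_ok => [big|/eqP pv].
  by have := leq_mul (leqnn t) (subset_leq_card sub); lia.
have :
    children S root :&: (piece c 0 :\: branch c v) \proper children S root :&: piece c 0.
  rewrite properE sub; apply/subsetPn; exists v.
    by rewrite 2!inE vr pv eqxx.
  by rewrite in_setI in_setD mem_branch_self ?andbF.
by move=> /proper_card/(leq_mul (leqnn t)); lia.
Qed.

Lemma cutting_exists : exists c, [/\ piece c 0 = [set root],
  forall j, 0 < j <= pieces c -> #|piece c j| <= d * t & pieces c * t <= #|T| + t * d].
Proof.
suff refine c : light_pieces c -> few_pieces c ->
    exists c', [/\ piece c' 0 = [set root], light_pieces c' & few_pieces c'].
  have top_none j : 0 < j <= 0 -> 0 = j by case: j.
  have top_none_lt j : 0 < j <= 0 -> 0 < j by case: j.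
  pose c := @Cutting _ S 0 (fun=> 0) (fun=> root) (fun=> isT) erefl (fun _ _ => erefl)
    top_none top_none_lt (fun _ _ _ => erefl).
  have [||c' [trunk light few]] := refine c; first by case.
    have trunk_all : piece c 0 = setT by apply/setP=> v; rewrite !inE.
    by rewrite /few_pieces trunk_all setIT cardsT.
  exists c'; split=> //; apply: leq_trans (_ : _ <= #|T| + t * #|children S root|) _.
    by apply: leq_trans few; rewrite -addnA leq_addr.
  by rewrite leq_add2l leq_mul2l children_le orbT.
have [n] := ubnP #|piece c 0|; elim: n c => // n IH c; rewrite ltnS => cn light few.
have [trunk|trunk_big] := eqVneq (piece c 0) [set root]; first by exists c.
have [v [v0 vr v_light v_ok]] := light_branch trunk_big.
have [c' [cs' trunk' piece1 pieceSS]] := cut_branch v0 vr.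
apply: (IH c'); last exact: few_pieces_cut v_ok cs' trunk' few.
  apply: leq_trans cn; rewrite trunk'; apply/proper_card/properP.
  split; first exact: subsetDl.
  by exists v; rewrite // in_setD mem_branch_self.
by move=> [//|[|j]]; rewrite cs' ?piece1 ?pieceSS //; apply: (light j.+1).
Qed.

End BoundedDegree.

End Cutting.

(** * The Friedman-Pippenger embedding *)

Section Expansion.
Variables (V : finType) (e : rel V).
Implicit Types W X Y Z : {set V}.

Definition nbrs Y X : {set V} := [set y in Y | [exists x in X, e x y]].

Definition joined (a : nat) W : Prop :=
  forall A B : {set V}, A \subset W -> B \subset W -> [disjoint A & B] ->
    a <= #|A| -> a <= #|B| -> exists x y, [/\ x \in A, y \in B & e x y].

Record expanding (k a : nat) Y : Prop := Expanding {
  expanding_small : forall X, X \subset Y -> #|X| <= a -> k * #|X| <= #|nbrs Y X|;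
  expanding_large : forall X, X \subset Y -> a <= #|X| ->
    #|Y| < #|nbrs Y X| + #|X| + a }.

Lemma nbrsP Y X y : reflect (y \in Y /\ exists2 x, x \in X & e x y) (y \in nbrs Y X).
Proof.
rewrite inE; apply: (iffP andP) => -[Yy].
  by move/existsP=> [x /andP[Xx exy]]; split=> //; exists x.
by move=> [x Xx exy]; split=> //; apply/existsP; exists x; rewrite Xx.
Qed.

Lemma nbrs_sub Y X : nbrs Y X \subset Y.
Proof. by apply/subsetP=> y /nbrsP[]. Qed.

Lemma nbrs0 Y : nbrs Y set0 = set0.
Proof. by apply/setP=> y; rewrite in_set0; apply/negP=> /nbrsP[_ [x]]; rewrite inE. Qed.

Lemma nbrsSS Y Y' X X' : Y \subset Y' -> X \subset X' -> nbrs Y X \subset nbrs Y' X'.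
Proof.
move=> /subsetP sY /subsetP sX; apply/subsetP=> y /nbrsP[Yy [x Xx exy]].
by apply/nbrsP; split; [apply: sY | exists x; first apply: sX].
Qed.

Lemma nbrsU Y X X' : nbrs Y (X :|: X') = nbrs Y X :|: nbrs Y X'.
Proof.
apply/eqP; rewrite eqEsubset subUset !nbrsSS ?subsetUl ?subsetUr // !andbT.
apply/subsetP=> y /nbrsP[Yy [x /setUP[Xx|Xx] exy]]; apply/setUP; [left|right];
  by apply/nbrsP; split=> //; exists x.
Qed.

Lemma joinedS a W W' : W' \subset W -> joined a W -> joined a W'.
Proof. by move=> sW'W jW A B sA sB; apply: jW; apply: subset_trans sW'W. Qed.

Lemma joined_card_nbrs a W X : joined a W -> X \subset W -> a <= #|X| ->
  #|W :\: X| < #|nbrs (W :\: X) X| + a.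
Proof.
move=> jW sXW aX; rewrite ltnNge; apply/negP=> few.
pose U := (W :\: X) :\: nbrs (W :\: X) X.
have aU : a <= #|U|.
  rewrite -(leq_add2l #|nbrs (W :\: X) X|) (leq_trans few) //.
  by rewrite (cardsDS (nbrs_sub _ _)) subnKC // subset_leq_card // nbrs_sub.
have UW : U \subset W by rewrite (subset_trans (subsetDl _ _)) ?subsetDl.
have dXU : [disjoint X & U].
  by apply/pred0P=> x /=; rewrite !in_setD; case: (x \in X); rewrite ?andbF.
have [x [y [Xx /setDP[WXy Ny] exy]]] := jW X U sXW UW dXU aX aU.
by case/negP: Ny; apply/nbrsP; split=> //; exists x.
Qed.

(* Remove a largest small set that expands badly: adding to it another small badly
   expanding set would give a set that contradicts either maximality or joinedness. *)
Lemma joined_expanding k a W : 0 < a -> joined a W -> (2 * k + 3) * a <= #|W| ->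
  exists Y, [/\ Y \subset W, #|W :\: Y| <= a & expanding k a Y].
Proof.
move=> a_gt0 jW W_big.
pose weak Z := [&& Z \subset W, #|Z| <= a & #|nbrs (W :\: Z) Z| <= k * #|Z|].
have weak0 : weak set0 by rewrite /weak sub0set cards0 nbrs0 cards0.
have [Z /and3P[ZW Za weakZ] Z_max] := arg_maxnP (fun Z : {set V} => #|Z|) weak0.
exists (W :\: Z); split; first exact: subsetDl.
  by rewrite setDDr setDv set0U (leq_trans _ Za) // subset_leq_card ?subsetIr.
split=> X sX => [Xa|aX].
  rewrite leqNgt; apply/negP=> weakX.
  have X_gt0 : 0 < #|X| by rewrite lt0n; apply: contraTneq weakX => ->; rewrite muln0.
  have dZX : Z :&: X = set0.
    apply/setP=> x; rewrite in_setI in_set0; apply/andP=> -[Zx Xx].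
    by have := subsetP sX x Xx; rewrite in_setD Zx.
  have cardU : #|Z :|: X| = #|Z| + #|X| by rewrite cardsU dZX cards0 subn0.
  have sU : Z :|: X \subset W by rewrite subUset ZW (subset_trans sX) ?subsetDl.
  have weakU : #|nbrs (W :\: (Z :|: X)) (Z :|: X)| <= k * #|Z :|: X|.
    rewrite cardU mulnDr nbrsU (leq_trans (leq_card_setU _ _)) //.
    have sW : W :\: (Z :|: X) \subset W :\: Z by rewrite setDS ?subsetUl.
    by rewrite leq_add // ?(ltnW (leq_ltn_trans _ weakX)) ?(leq_trans _ weakZ) //
      subset_leq_card // nbrsSS.
  have [Ua|/ltnW Ua] := leqP #|Z :|: X| a.
    have := Z_max (Z :|: X); rewrite /weak sU Ua weakU => /(_ isT).
    by rewrite cardU; lia.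
  have := joined_card_nbrs jW sU Ua; rewrite cardsDS //.
  have : #|Z :|: X| <= 2 * a by rewrite cardU; lia.
  by move: weakU W_big a_gt0; clear; nia.
have := joined_card_nbrs (joinedS (subsetDl W Z) jW) sX aX.
have : #|nbrs (W :\: Z :\: X) X| <= #|nbrs (W :\: Z) X|.
  by rewrite subset_leq_card // nbrsSS ?subsetDl.
by rewrite cardsDS //; lia.
Qed.

End Expansion.

Section FriedmanPippenger.
Variables (V T : finType) (e : rel V) (S : rooted_tree T).
Variables (P : {set T}) (r : T) (d a : nat) (Y : {set V}).
Hypothesis a_gt0 : 0 < a.
Hypothesis r_in : r \in P.
Hypothesis parent_in : forall v, v \in P -> v != r ->
  v != tree_root S /\ parent S v \in P.
Hypothesis children_le : forall v, #|children S v :\ r| <= d.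
Hypothesis expY : expanding e d.+1 a Y.
Hypothesis room : #|P| + (2 * d + 3) * a <= #|Y|.
Implicit Types (D : {set T}) (phi : T -> V) (X : {set V}).

(* The number of free neighbours that X must still provide: one for each
   unembedded child of an embedded vertex of X, and d for every free vertex of X. *)
Definition demand D phi X : nat :=
  #|[set w in P :\: D | (parent S w \in D) && (phi (parent S w) \in X)]|
    + d * #|X :\: phi @: D|.

Definition supply D phi X : nat := #|nbrs e Y X :\: phi @: D|.

Record good_embedding D phi : Prop := GoodEmbedding {
  good_root : r \in D;
  good_sub : D \subset P;
  good_parent : forall v, v \in D -> v != r -> parent S v \in D;
  good_inj : {in D &, injective phi};
  good_in : forall v, v \in D -> phi v \in Y;
  good_edge : forall v, v \in D -> v != r -> e (phi (parent S v)) (phi v);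
  good_supply : forall X, X \subset Y -> #|X| <= 2 * a ->
    demand D phi X <= supply D phi X }.

Lemma demandUI D phi X X' :
  demand D phi (X :|: X') + demand D phi (X :&: X') = demand D phi X + demand D phi X'.
Proof.
rewrite /demand.
pose pending X := [set w in P :\: D | (parent S w \in D) && (phi (parent S w) \in X)].
rewrite -!/(pending _).
have -> : pending (X :|: X') = pending X :|: pending X'.
  by apply/setP=> w; rewrite !inE -!andb_orr.
have -> : pending (X :&: X') = pending X :&: pending X'.
  by apply/setP=> w; rewrite !inE; case: (w \in P); case: (w \in D); case: (_ \in D).
rewrite setDUl setDIl; have := cardsUI (pending X) (pending X').
by have := cardsUI (X :\: phi @: D) (X' :\: phi @: D); nia.
Qed.

Lemma supplyUI D phi X X' :
  supply D phi (X :|: X') + supply D phi (X :&: X') <= supply D phi X + supply D phi X'.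
Proof.
rewrite /supply nbrsU setDUl -[leqRHS]cardsUI leq_add2l.
by rewrite subset_leq_card // -setDIl setSD // subsetI !nbrsSS ?subsetIl ?subsetIr.
Qed.

Lemma demand0 D phi : demand D phi set0 = 0.
Proof.
rewrite /demand set0D cards0 muln0 addn0; apply/eqP; rewrite cards_eq0.
by apply/eqP/setP=> w; rewrite !inE !andbF.
Qed.

Lemma demand_le D phi X : {in D &, injective phi} -> r \in D ->
  demand D phi X <= d * #|X|.
Proof.
move=> phi_inj rD; rewrite /demand -(cardsID (phi @: D) X) mulnDr leq_add2r.
pose occupied := [set v in D | phi v \in X].
have -> : #|X :&: phi @: D| = #|occupied|.
  rewrite -(@card_in_imset _ _ phi occupied).
    apply: eq_card => x; apply/setIP/imsetP => [[Xx /imsetP[v vD xE]]|[v + ->]].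
      by exists v; rewrite // inE vD -xE.
    by rewrite inE => /andP[vD vX]; rewrite imset_f.
  by move=> u v; rewrite !inE => /andP[uD _] /andP[vD _]; apply: phi_inj.
rewrite -sum1_card (partition_big (parent S) (mem occupied)) => [|w] /=; last first.
  by rewrite !inE => /andP[_ ->].
rewrite mulnC -sum_nat_const; apply: leq_sum => v _.
apply: leq_trans (children_le v); rewrite -sum1_card.
rewrite sum1dep_card sum1_card subset_leq_card //; apply/subsetP=> w.
rewrite !inE => /andP[/andP[/andP[wD wP] _] ->]; rewrite andbT.
have wr : w != r by apply: contraNneq wD => ->.
by rewrite wr; case: (parent_in wP wr).
Qed.

Lemma good_singleton y : y \in Y -> good_embedding [set r] (fun=> y).
Proof.
move=> yY.
have inj : {in [set r] &, injective (fun=> y)} by move=> u v /set1P-> /set1P->.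
split=> //; first exact: set11.
- by rewrite sub1set.
- by move=> v /set1P->; rewrite eqxx.
- by move=> v /set1P->; rewrite eqxx.
move=> X sX X2a; apply: leq_trans (demand_le X inj (set11 r)) _.
have lose1 : #|nbrs e Y X| <= supply [set r] (fun=> y) X + 1.
  by rewrite /supply imset_set1 -(cards1 y) leq_card_setD.
have [Xa|/ltnW aX] := leqP #|X| a.
  have := expanding_small expY sX Xa; have [->|X_gt0] := posnP #|X|;
    first by rewrite !muln0.
  by rewrite mulSn; lia.
have := expanding_large expY sX aX.
have : 0 < #|P| by apply/card_gt0P; exists r.
by move: lose1 X2a room; clear; nia.
Qed.

Lemma good_large D phi X : good_embedding D phi -> X \subset Y -> a < #|X| ->
  #|X| <= 2 * a -> demand D phi X < supply D phi X.
Proof.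
move=> gD sX aX X2a.
have := demand_le X (good_inj gD) (good_root gD).
have := expanding_large expY sX (ltnW aX).
have : #|nbrs e Y X| <= supply D phi X + #|P|.
  apply: leq_trans (leq_card_setD _ (phi @: D)) _; rewrite leq_add2l.
  by rewrite (leq_trans (leq_imset_card _ _)) ?subset_leq_card ?(good_sub gD).
by move: X2a room; clear; nia.
Qed.

Definition critical D phi X : bool :=
  [&& X \subset Y, #|X| <= a & demand D phi X == supply D phi X].

Lemma good_critical D phi X : good_embedding D phi -> X \subset Y -> #|X| <= 2 * a ->
  supply D phi X <= demand D phi X -> critical D phi X.
Proof.
move=> gD sX X2a tight; rewrite /critical sX eqn_leq tight good_supply // !andbT.
by rewrite leqNgt; apply: contraTN tight => aX; rewrite -ltnNge good_large.
Qed.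

Lemma criticalU D phi X X' : good_embedding D phi ->
  critical D phi X -> critical D phi X' -> critical D phi (X :|: X').
Proof.
move=> gD /and3P[sX Xa /eqP tightX] /and3P[sX' X'a /eqP tightX'].
apply: good_critical => //; first by rewrite subUset sX.
  by rewrite (leq_trans (leq_card_setU _ _)) // mul2n -addnn leq_add.
have := good_supply gD (subset_trans (subsetIl X X') sX).
have -> : #|X :&: X'| <= 2 * a.
  by rewrite (leq_trans (subset_leq_card (subsetIl _ _))) // (leq_trans Xa) ?leq_pmull.
move=> /(_ isT); have := demandUI D phi X X'; have := supplyUI D phi X X'.
by rewrite tightX tightX'; lia.
Qed.

Section Extension.
Variables (D : {set T}) (phi : T -> V) (w : T).
Hypothesis goodD : good_embedding D phi.
Hypothesis w_new : w \in P :\: D.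
Hypothesis parent_w : parent S w \in D.
Local Notation u := (phi (parent S w)).
Local Notation image := (phi @: D).
Local Notation phi_at y := [eta phi with w |-> y].

Let wP : w \in P. Proof. by case/setDP: w_new. Qed.
Let wD : w \notin D. Proof. by case/setDP: w_new. Qed.

Lemma extension_old y v : v \in D -> phi_at y v = phi v.
Proof. by move=> vD /=; rewrite ifN //; apply: contraNneq wD => <-. Qed.

Lemma extension_image y : phi_at y @: (w |: D) = y |: image.
Proof.
rewrite imsetU1 /= eqxx; congr (_ |: _).
by apply: eq_in_imset => v /extension_old.
Qed.

Lemma supply_extension y X :
  supply D phi X = (y \in nbrs e Y X :\: image) + supply (w |: D) (phi_at y) X.
Proof.
rewrite /supply extension_image (cardsD1 y); congr (_ + #|pred_of_set _|).
by rewrite setDDl setUC.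
Qed.

Lemma demand_extension y X : y \notin image ->
  demand (w |: D) (phi_at y) X + (u \in X) <= demand D phi X.
Proof.
move=> y_new; rewrite /demand extension_image.
pose pending := [set v in P :\: D | (parent S v \in D) && (phi (parent S v) \in X)].
rewrite -/pending; set pending' := [set v in P :\: (w |: D) | _].
pose new_children := if y \in X then children S w :\ r else set0.
have card_pending : #|pending| = (u \in X) + #|pending :\ w|.
  by rewrite (cardsD1 w pending) !inE wP wD parent_w.
have : #|pending'| <= #|pending :\ w| + #|new_children|.
  apply: leq_trans (leq_card_setU _ _); apply: subset_leq_card; apply/subsetP=> v.
  rewrite inE in_setD in_setU1 negb_or => /andP[/andP[/andP[vw vD] vP] /andP[]].
  have vr : v != r by apply: contraNneq vD => ->; apply: good_root goodD.
  have [v_root _] := parent_in vP vr; case/setU1P=> [pv|pv].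
    by rewrite pv /= eqxx /new_children => ->; rewrite !inE vr v_root pv eqxx orbT.
  by rewrite extension_old // => pX; rewrite !inE vw vD vP pv pX.
have : d * #|X :\: (y |: image)| + #|new_children| <= d * #|X :\: image|.
  rewrite setUC -setDDl /new_children (cardsD1 y (X :\: image)) in_setD y_new.
  case: ifP => _ /=; last by rewrite cards0 addn0 leq_mul2l leq_addl orbT.
  by rewrite mulnDr muln1 addnC leq_add2r children_le.
move=> free_le pending_le; rewrite card_pending addnC -[leqRHS]addnA leq_add2l.
apply: leq_trans (leq_add pending_le (leqnn _)) _.
by rewrite -addnA leq_add2l addnC.
Qed.

Lemma good_extension y : y \in nbrs e Y [set u] :\: image ->
  (forall X, X \subset Y -> #|X| <= 2 * a ->
     demand (w |: D) (phi_at y) X <= supply (w |: D) (phi_at y) X) ->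
  good_embedding (w |: D) (phi_at y).
Proof.
case/setDP=> /nbrsP[yY [_ /set1P-> euy]] y_new supply_ok.
have new_neq v : v \in D -> phi v <> y by move=> vD E; case/imsetP: y_new; exists v.
have at_w : phi_at y w = y by rewrite /= eqxx.
split=> //.
- by rewrite setU1r // (good_root goodD).
- by rewrite subUset sub1set wP (good_sub goodD).
- move=> v /setU1P[->|vD] vr; first by rewrite setU1r.
  by rewrite setU1r // (good_parent goodD).
- move=> v v' /setU1P[->|vD] /setU1P[->|v'D] //; rewrite ?at_w ?extension_old //.
  + by move=> E; case: (new_neq v' v'D).
  + by move=> E; case: (new_neq v vD).
  + exact: (good_inj goodD).
- move=> v /setU1P[->|vD]; first by rewrite at_w.
  by rewrite extension_old // (good_in goodD).
- move=> v /setU1P[->|vD] vr; first by rewrite at_w extension_old.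
  by rewrite !extension_old ?(good_parent goodD) // (good_edge goodD).
Qed.

Lemma good_extension_or_critical y : y \in nbrs e Y [set u] :\: image ->
  good_embedding (w |: D) (phi_at y) \/
  exists X, [/\ critical D phi X, u \notin X & y \in nbrs e Y X].
Proof.
move=> y_in; have [_ y_new] := setDP y_in.
have [/existsP[X /and3P[sX X2a bad]]|ok] := boolP [exists X : {set V},
    [&& X \subset Y, #|X| <= 2 * a &
      supply (w |: D) (phi_at y) X < demand (w |: D) (phi_at y) X]].
  have supplyE := supply_extension y X; rewrite in_setD y_new /= in supplyE.
  have le_demand := leq_trans (leq_add bad (leqnn (u \in X))) (demand_extension X y_new).
  have := leq_trans le_demand (good_supply goodD sX X2a).
  rewrite supplyE addSnnS addnC leq_add2r.
  case uX: (u \in X); case yX: (y \in nbrs e Y X) => // _; right; exists X.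
  split; rewrite ?uX //; apply: good_critical => //.
  by rewrite supplyE yX; move: le_demand; rewrite uX addn0.
left; apply: good_extension => // X sX X2a.
by move/existsPn/(_ X): ok; rewrite sX X2a /= -leqNgt.
Qed.

Lemma critical_misses_nbr X : critical D phi X -> u \notin X ->
  exists2 y, y \in nbrs e Y [set u] :\: image & y \notin nbrs e Y X.
Proof.
case/and3P=> sX Xa /eqP tight uX; apply/subsetPn/negP=> covered.
have sU : X :|: [set u] \subset Y by rewrite subUset sX sub1set (good_in goodD).
have cU : #|X :|: [set u]| <= 2 * a.
  by rewrite (leq_trans (leq_card_setU _ _)) // cards1 mul2n -addnn leq_add.
have := good_supply goodD sU cU; have := demandUI D phi X [set u].
have -> : X :&: [set u] = set0 by apply/eqP; rewrite setI_eq0 disjoint_sym disjoints1.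
have -> : supply D phi (X :|: [set u]) = supply D phi X.
  rewrite /supply nbrsU setDUl (setUidPl _) //; apply/subsetP=> y yu.
  by rewrite in_setD (subsetP covered) // andbT; case/setDP: yu.
have : 0 < demand D phi [set u].
  rewrite ltn_addr //; apply/card_gt0P; exists w.
  by rewrite !inE wP wD parent_w eqxx.
rewrite demand0 tight addn0 => d_gt0 ->; rewrite -[X in _ <= X]addn0 leq_add2l leqn0.
by case: (demand _ _ _) d_gt0.
Qed.

(* If no neighbour of u were suitable, a maximal critical set avoiding u would
   cover all of them, as critical sets are closed under union. *)
Lemma good_extension_exists : exists y, good_embedding (w |: D) (phi_at y).
Proof.
pose avoiding X := critical D phi X && (u \notin X).
have avoiding0 : avoiding set0.
  rewrite /avoiding in_set0 andbT good_critical ?sub0set ?cards0 //.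
  by rewrite /supply nbrs0 set0D cards0.
have [M /andP[critM uM] M_max] := arg_maxnP (fun X : {set V} => #|X|) avoiding0.
have [y y_in yM] := critical_misses_nbr critM uM; exists y.
have [//|[X [critX uX yX]]] := good_extension_or_critical y_in.
have le : #|M :|: X| <= #|M|.
  by apply: M_max; rewrite /avoiding criticalU //= in_setU negb_or uM.
case/negP: yM; have -> : M = M :|: X by apply/eqP; rewrite eqEcard subsetUl.
by rewrite nbrsU in_setU yX orbT.
Qed.

End Extension.

Lemma tree_embedding y : y \in Y -> exists phi : T -> V, [/\ phi r = y,
  {in P &, injective phi}, forall v, v \in P -> phi v \in Y
  & forall v, v \in P -> v != r -> e (phi (parent S v)) (phi v)].
Proof.
move=> yY.
suff grow n D phi : #|P :\: D| = n -> good_embedding D phi -> phi r = y ->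
    exists2 psi, good_embedding P psi & psi r = y.
  have [psi gP <-] := grow _ _ _ erefl (good_singleton yY) erefl.
  exists psi; split=> //; first exact: good_inj gP.
    exact: good_in gP.
  exact: good_edge gP.
elim: n D phi => [|n IH] D phi cPD gD phir.
  have E : D = P.
    apply/eqP; rewrite eqEsubset (good_sub gD) -setD_eq0 -cards_eq0.
    by rewrite cPD.
  by exists phi; rewrite // -E.
have [v0 v0_new] : exists v, v \in P :\: D by apply/card_gt0P; rewrite cPD.
have [v v_new v_min] := arg_minnP (depth S) v0_new.
have /setDP[vP vD] := v_new.
have vr : v != r by apply: contraNneq vD => ->; apply: good_root gD.
have [v_root pP] := parent_in vP vr.
have pD : parent S v \in D.
  apply: contraT => pD; have /v_min : parent S v \in P :\: D by rewrite in_setD pD.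
  by rewrite leqNgt depth_parent.
have [z gD'] := good_extension_exists gD v_new pD.
apply: IH gD' _; last by rewrite /= eq_sym (negPf vr).
by move: cPD; rewrite (cardsD1 v (P :\: D)) in_setD vD vP setDDl setUC => -[].
Qed.

End FriedmanPippenger.

(** * Finite product probability spaces *)

Local Open Scope ring_scope.

Section ProductProbability.
Variables (R : numFieldType) (I X : finType) (mu : I -> X -> R).
Hypothesis mu_ge0 : forall i x, 0 <= mu i x.
Hypothesis mu_sum : forall i, \sum_x mu i x = 1.
Implicit Types (w : {ffun I -> X}) (E F : {ffun I -> X} -> Prop).

Definition weight w : R := \prod_i mu i (w i).

Definition prob E : R := \sum_(w | `[< E w >]) weight w.

Definition splice (A : {set I}) w w' : {ffun I -> X} :=
  [ffun i => if i \in A then w i else w' i].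

Lemma weight_ge0 w : 0 <= weight w.
Proof. exact: prodr_ge0. Qed.

Lemma prob_ge0 E : 0 <= prob E.
Proof. by apply: sumr_ge0 => w _; apply: weight_ge0. Qed.

Lemma probE E : prob E = \sum_w weight w * `[< E w >]%:R.
Proof.
by rewrite /prob big_mkcond; apply: eq_bigr => w _; case: ifP; rewrite ?mulr1 ?mulr0.
Qed.

Lemma expectation_prod (g : I -> X -> R) :
  \sum_w weight w * \prod_i g i (w i) = \prod_i \sum_x mu i x * g i x.
Proof.
rewrite bigA_distr_bigA /=; apply: eq_bigr => w _.
by rewrite /weight -big_split.
Qed.

Lemma sum_weight : \sum_w weight w = 1.
Proof. by rewrite -bigA_distr_bigA big1. Qed.

Lemma prob_le E F : (forall w, E w -> F w) -> prob E <= prob F.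
Proof.
move=> EF; rewrite !probE; apply: ler_sum => w _.
rewrite ler_wpM2l ?weight_ge0 // ler_nat.
by case: asboolP => // /EF/asboolT->.
Qed.

Lemma prob_true E : (forall w, E w) -> prob E = 1.
Proof. by move=> Et; rewrite -sum_weight; apply: eq_bigl => w; rewrite asboolT. Qed.

Lemma prob_false E : (forall w, ~ E w) -> prob E = 0.
Proof. by move=> Ef; rewrite /prob big_pred0 // => w; rewrite asboolF. Qed.

Lemma prob_not E : prob (fun w => ~ E w) = 1 - prob E.
Proof.
rewrite -sum_weight (bigID (fun w => `[< E w >])) /= -/(prob E) addrC addrK.
by apply: eq_bigl => w; rewrite asbool_neg.
Qed.

Lemma prob_or E F : prob (fun w => E w \/ F w) <= prob E + prob F.
Proof.
rewrite !probE -big_split; apply: ler_sum => w _ /=.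
rewrite -mulrDr ler_wpM2l ?weight_ge0 // -natrD ler_nat asbool_or.
by case: `[< E w >]; case: `[< F w >].
Qed.

Lemma prob_exists (J : finType) (P : pred J) (E : J -> {ffun I -> X} -> Prop) (c : R) :
  (forall j, P j -> prob (E j) <= c) ->
  prob (fun w => exists2 j, P j & E j w) <= #|P|%:R * c.
Proof.
move=> le; apply: (@le_trans _ _ (\sum_(j | P j) prob (E j))); last first.
  by rewrite mulr_natl -sumr_const; apply: ler_sum.
rewrite probE; under [leRHS]eq_bigr do rewrite probE.
rewrite exchange_big; apply: ler_sum => w _ /=.
rewrite -mulr_sumr ler_wpM2l ?weight_ge0 //.
case: asboolP => [[j Pj Ew]|_]; last by rewrite sumr_ge0.
by rewrite (bigD1 j) ?Pj //= (asboolT Ew) lerDl sumr_ge0.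
Qed.

Lemma weight_splice A w w' :
  weight (splice A w w') * weight (splice A w' w) = weight w * weight w'.
Proof.
rewrite /weight -!big_split; apply: eq_bigr => i _ /=; rewrite !ffunE.
by case: ifP => // _; rewrite mulrC.
Qed.

Lemma splice_splice A w w' : splice A (splice A w w') (splice A w' w) = w.
Proof. by apply/ffunP=> i; rewrite !ffunE; case: (i \in A). Qed.

Lemma prob_resample A F :
  prob F = \sum_w weight w * prob (fun w' => F (splice A w w')).
Proof.
under [RHS]eq_bigr do rewrite probE mulr_sumr.
rewrite pair_big /=.
pose swap (q : {ffun I -> X} * {ffun I -> X}) := (splice A q.1 q.2, splice A q.2 q.1).
have swapK : involutive swap by case=> w w'; rewrite /swap /= !splice_splice.
rewrite (reindex_inj (inv_inj swapK)) /=.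
transitivity (\sum_w \sum_w' weight w * (weight w' * `[< F w >]%:R)).
  rewrite probE; apply: eq_bigr => w _.
  by rewrite -mulr_sumr -mulr_suml sum_weight mul1r.
rewrite pair_big /=; apply: eq_bigr => -[w w'] _ /=.
by rewrite splice_splice !mulrA weight_splice.
Qed.

Lemma prob_resample_ge A E F (del : R) : 0 <= del ->
  (forall w, E w -> prob (fun w' => ~ F (splice A w w')) <= del) ->
  prob E - del <= prob F.
Proof.
move=> del0 le; rewrite (prob_resample A F).
have -> : prob E - del = \sum_w weight w * (`[< E w >]%:R - del).
  under eq_bigr do rewrite mulrBr.
  by rewrite sumrB -mulr_suml sum_weight mul1r probE.
apply: ler_sum => w _; rewrite ler_wpM2l ?weight_ge0 //.
case: asboolP => [Ew|_].
  by rewrite lerBlDr -lerBlDl -prob_not le.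
by rewrite sub0r (le_trans _ (prob_ge0 _)) // oppr_le0.
Qed.

Lemma prob_resample_le A F (del : R) :
  (forall w, prob (fun w' => F (splice A w w')) <= del) -> prob F <= del.
Proof.
move=> le; rewrite (prob_resample A F) -[del]mul1r -sum_weight mulr_suml.
by apply: ler_sum => w _; rewrite ler_wpM2l ?weight_ge0.
Qed.

Lemma prob_avoid (J : finType) (L : {set J}) (f : J -> I)
    (S : J -> pred X) (theta : R) :
  {in L &, injective f} ->
  (forall j, j \in L -> theta <= \sum_(x | S j x) mu (f j) x) ->
  prob (fun w => forall j, j \in L -> ~~ S j (w (f j))) <= (1 - theta) ^+ #|L|.
Proof.
move=> f_inj le.
pose g i x : R := \prod_(j in L | f j == i) (~~ S j x)%:R.
have -> : prob (fun w => forall j, j \in L -> ~~ S j (w (f j)))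
    = \sum_w weight w * \prod_i g i (w i).
  rewrite probE; apply: eq_bigr => w _; congr (_ * _).
  transitivity (\prod_(j in L) (~~ S j (w (f j)))%:R : R).
    case: asboolP => [av|nav]; first by rewrite big1 // => j /av->.
    have [/existsP[j /andP[jL Sj]]|none] :=
      boolP [exists j, (j \in L) && S j (w (f j))].
      by rewrite (bigD1 j) //= Sj mul0r.
    by case: nav => j jL; move/existsPn/(_ j): none; rewrite jL.
  rewrite (partition_big f xpredT) //=; apply: eq_bigr => i _.
  by apply: eq_bigr => j /andP[_ /eqP->].
rewrite expectation_prod -prodr_const (partition_big f xpredT) //=.
apply: ler_prod => i _; rewrite sumr_ge0 => [|x _] /=; last first.
  by rewrite mulr_ge0 ?prodr_ge0.
have [j /andP[jL /eqP fj]|none] := pickP [pred j | (j \in L) && (f j == i)]; last first.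
  by under eq_bigr do rewrite /g big_pred0 // mulr1; rewrite mu_sum big_pred0.
have only_j j' : (j' \in L) && (f j' == i) = (j' == j).
  apply/andP/eqP=> [[j'L /eqP fj']|->]; last by rewrite jL fj.
  by apply: f_inj; rewrite ?fj'.
under eq_bigr do rewrite /g (big_pred1 j only_j).
rewrite (big_pred1 j only_j) lerBrDr -[leRHS](mu_sum i).
apply: le_trans (lerD (lexx _) (le j jL)) _; rewrite fj.
rewrite [X in _ + X]big_mkcond -big_split; apply: ler_sum => x _ /=.
by case: (S j x); rewrite ?mulr0 ?mulr1 ?add0r ?addr0.
Qed.

Lemma prob_count_ge (L : {set I}) (S : I -> pred X) (p : R) (b : nat) :
  (forall i, i \in L -> \sum_(x | S i x) mu i x <= p) ->
  prob (fun w => (b <= #|[set i in L | S i (w i)]|)%N) <= (1 + p) ^+ #|L| / 2 ^+ b.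
Proof.
move=> le; rewrite ler_pdivlMr ?exprn_gt0 //.
pose g i x : R := if (i \in L) && S i x then 2 else 1.
apply: (@le_trans _ _ (\sum_w weight w * \prod_i g i (w i))).
  rewrite probE mulr_suml; apply: ler_sum => w _.
  rewrite -mulrA ler_wpM2l ?weight_ge0 //.
  have -> : \prod_i g i (w i) = 2 ^+ #|[set i in L | S i (w i)]|.
    rewrite -prodr_const [RHS]big_mkcond /=; apply: eq_bigr => i _.
    by rewrite /g inE.
  case: asboolP => bl; last by rewrite mul0r exprn_ge0.
  by rewrite mul1r ler_eXn2l // ltr1n.
rewrite expectation_prod -prodr_const [leRHS]big_mkcond /=; apply: ler_prod => i _.
rewrite sumr_ge0 => [|x _] /=; last by rewrite mulr_ge0 // /g; case: ifP.
rewrite /g; case: ifP => iL /=; last by under eq_bigr do rewrite mulr1; rewrite mu_sum.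
have -> : \sum_x mu i x * (if S i x then 2 else 1) = 1 + \sum_(x | S i x) mu i x.
  rewrite -[X in X + _](mu_sum i) [X in _ + X]big_mkcond -big_split;
    apply: eq_bigr => x _ /=.
  by case: ifP => _; rewrite ?mulr1 ?addr0 // mulrDr mulr1.
by rewrite lerD2l le.
Qed.

End ProductProbability.

(** * Random coloured subgraphs *)

Local Notation outcome G K := {ffun {set (vertex G)} -> bool * K}.
Local Notation kept w e := (w e).1.
Local Notation colour w e := (w e).2.

Section EdgeLaw.
Variables (R : numFieldType) (G : sgraph) (K : finType) (p : R).
Hypotheses (p_ge0 : 0 <= p) (p_le1 : p <= 1) (K_gt0 : (0 < #|K|)%N).

Definition presence_law (e : {set G}) (b : bool) : R :=
  if e \in edges G then (if b then p else 1 - p) else (~~ b)%:R.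

Definition edge_law (e : {set G}) (x : bool * K) : R := presence_law e x.1 / #|K|%:R.

Let card_K_neq0 : #|K|%:R != 0 :> R. Proof. by rewrite pnatr_eq0 -lt0n. Qed.

Lemma edge_law_ge0 e x : 0 <= edge_law e x.
Proof.
rewrite divr_ge0 // /presence_law; case: ifP => _ //.
by case: ifP => _ //; rewrite subr_ge0.
Qed.

Lemma sum_edge_law e : \sum_x edge_law e x = 1.
Proof.
rewrite -(pair_bigA _ (fun b (c : K) => presence_law e b / #|K|%:R)) /=.
rewrite (eq_bigr (presence_law e)) => [|b _];
  last by rewrite sumr_const -[LHS]mulr_natr divfK.
by rewrite big_bool /presence_law /=; case: ifP => _; rewrite ?subrKC ?add0r.
Qed.

Lemma edge_law_kept_in (e : {set G}) (D : {set K}) : e \in edges G ->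
  \sum_(x | x.1 && (x.2 \in D)) edge_law e x = p * #|D|%:R / #|K|%:R.
Proof.
move=> eG; rewrite -(pair_big id (mem D) (fun b c => presence_law e b / #|K|%:R)) /=.
rewrite (big_pred1 true) => [|[]] //.
by rewrite sumr_const /presence_law eG -[LHS]mulr_natr mulrAC.
Qed.

Lemma edge_law_kept (e : {set G}) : e \in edges G -> \sum_(x | x.1) edge_law e x = p.
Proof.
move=> eG; have := edge_law_kept_in [set: K] eG; rewrite cardsT mulfK //.
by move=> <-; apply: eq_bigl => x; rewrite inE andbT.
Qed.

Lemma weight_edge_law (H : {set {set G}}) (c : {ffun {set G} -> K}) :
  weight edge_law [ffun e => (e \in H, c e)] =
  (if H \subset edges G then p ^+ #|H| * (1 - p) ^+ #|edges G :\: H| else 0)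
    / #|{ffun {set G} -> K}|%:R.
Proof.
rewrite /weight /edge_law; under eq_bigr do rewrite ffunE /=.
rewrite big_split /= prodr_const card_ffun natrX exprVn; congr (_ / _).
rewrite /presence_law; case: ifPn => [sHE|/subsetPn[e eH eE]]; last first.
  by rewrite (bigD1 e) //= (negPf eE) eH mul0r.
rewrite -!prodr_const [X in _ = X * _]big_mkcond [X in _ = _ * X]big_mkcond -big_split /=.
apply: eq_bigr => e _; rewrite in_setD; case eH: (e \in H) => /=.
  by rewrite (subsetP sHE) // mulr1.
by case: (e \in edges G); rewrite ?mul1r.
Qed.

End EdgeLaw.

Lemma coloured_Gp_probE (R : realType) (G : sgraph) (K : finType) (p : R)
    (Q : {set {set G}} -> {ffun {set G} -> K} -> bool) :
  coloured_Gp_prob p Q =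
  prob (@edge_law R G K p) (fun w => Q [set e | kept w e] [ffun e => colour w e]).
Proof.
pose join (q : {set {set G}} * {ffun {set G} -> K}) : outcome G K :=
  [ffun e => (e \in q.1, q.2 e)].
pose split (w : outcome G K) := ([set e | kept w e], [ffun e => colour w e]).
have joinK : cancel join split.
  by case=> H c; congr pair; [apply/setP=> e; rewrite inE | apply/ffunP=> e];
    rewrite !ffunE.
have splitK : cancel split join.
  by move=> w; apply/ffunP=> e; rewrite !ffunE inE; case: (w e).
rewrite probE (reindex join) /=; last by exists split => ? _.
pose term H c := weight (edge_law p) (join (H, c)) * (Q H c)%:R.
transitivity (\sum_q term q.1 q.2); last first.
  by apply: eq_bigr => -[H c] _; rewrite /term asboolb; case: (joinK (H, c)) => -> ->.
rewrite -(pair_bigA _ term) /coloured_Gp_prob big_mkcond; apply: eq_bigr => H _ /=.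
under eq_bigr do rewrite /term weight_edge_law /=.
rewrite -mulr_sumr; case: ifP => _; last by rewrite !mul0r.
rewrite -natr_sum [in RHS]mulrAC [in LHS]mulrA -(sum1dep_card (Q H)).
by congr (_ * _%:R / _); rewrite [LHS]big_mkcond; apply: eq_bigr => c _; case: (Q H c).
Qed.

(** * Rainbow graphs inside a block *)

Section Block.
Variables (G : sgraph) (K : finType).
Implicit Types (A B W : {set G}) (L : {set {set G}}) (D : {set K}) (w : outcome G K).

Definition between A B : {set {set G}} :=
  [set e in edges G | [exists x in A, exists y in B, e == [set x; y]]].

Definition inner W : {set {set G}} := [set e in edges G | e \subset W].

Definition present w L : {set {set G}} := [set e in L | kept w e].

Definition seen w L : {set K} := [set colour w e | e in present w L].

Definition covers w W D A B : bool :=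
  [exists e in between A B,
     kept w e && (colour w e \in D :\: seen w (inner W :\: between A B))].

Definition covering (a : nat) w W D : Prop := forall A B, A \subset W -> B \subset W ->
  [disjoint A & B] -> (a <= #|A|)%N -> (a <= #|B|)%N -> covers w W D A B.

Record rainbow_rel w W D (er : rel G) : Prop := RainbowRel {
  rainbow_rel_in : forall x y, er x y ->
    [/\ [set x; y] \in inner W, kept w [set x; y] & colour w [set x; y] \in D];
  rainbow_rel_inj : forall x y x' y', er x y -> er x' y' ->
    colour w [set x; y] = colour w [set x'; y'] -> [set x; y] = [set x'; y'] }.

Lemma between_sub_inner A B W : A \subset W -> B \subset W ->
  between A B \subset inner W.
Proof.
move=> sA sB; apply/subsetP=> e; rewrite !inE => /andP[-> /existsP[x /andP[xA]]].
case/existsP=> y /andP[yB /eqP->] /=.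
by rewrite subUset !sub1set (subsetP sA) ?(subsetP sB).
Qed.

Lemma card_inner W : (#|inner W| <= #|W| * #|W|)%N.
Proof.
rewrite -cardsX; apply: leq_trans (leq_imset_card (fun q : G * G => [set q.1; q.2]) _).
apply/subset_leq_card/subsetP=> e; rewrite inE => /andP[].
rewrite inE => /existsP[x /existsP[y /andP[_ /eqP->]]].
rewrite subUset !sub1set => /andP[xW yW]; apply/imsetP; exists (x, y) => //.
by rewrite inE /= xW.
Qed.

Lemma seenP w L c :
  reflect (exists2 e, e \in L & kept w e /\ colour w e = c) (c \in seen w L).
Proof.
apply: (iffP imsetP) => [[e]|[e eL [we <-]]].
  by rewrite inE => /andP[eL we] ->; exists e.
by exists e; rewrite ?inE ?eL.
Qed.

Lemma card_seen w L : (#|seen w L| <= #|present w L|)%N.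
Proof. exact: leq_imset_card. Qed.

Lemma presentS w L L' : L \subset L' -> present w L \subset present w L'.
Proof. by move=> /subsetP sL; apply/subsetP=> e; rewrite !inE => /andP[/sL-> ->]. Qed.

Lemma eq_present w w' L : {in L, w =1 w'} -> present w L = present w' L.
Proof.
by move=> E; apply/setP=> e; rewrite [LHS]inE [RHS]inE; apply: andb_id2l => /E->.
Qed.

Lemma eq_seen w w' L : {in L, w =1 w'} -> seen w L = seen w' L.
Proof.
move=> E; rewrite /seen (eq_present E); apply: eq_in_imset => e.
by rewrite inE => /andP[/E-> _].
Qed.

Lemma eq_covering a w w' W D : {in inner W, w =1 w'} -> covering a w W D ->
  covering a w' W D.
Proof.
move=> E cov A B sA sB dAB aA aB.
have [e /andP[eAB eD]] := existsP (cov A B sA sB dAB aA aB).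
apply/existsP; exists e; rewrite eAB -E ?(subsetP (between_sub_inner sA sB)) //.
by rewrite -(@eq_seen w) // => e' /setDP[/E].
Qed.

(* One representative edge is kept for each colour of D seen inside W.  If some
   colour is seen only on edges between A and B, its representative lies there. *)
Lemma covering_rainbow_joined a w W D : covering a w W D ->
  exists2 er : rel G, rainbow_rel w W D er & joined er a W.
Proof.
move=> cov.
pose rep c := [pick e | (e \in inner W) && (kept w e && (colour w e == c))].
have repP c e : rep c = Some e -> [/\ e \in inner W, kept w e & colour w e = c].
  by rewrite /rep; case: pickP => // e' /and3P[? ? /eqP ?] [<-].
exists [rel x y | [exists c in D, rep c == Some [set x; y]]].
  split=> [x y|x y x' y'] /= /existsP[c /andP[cD /eqP rc]].
    by have [i1 i2 i3] := repP _ _ rc; rewrite i1 i2 i3.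
  case/existsP=> c' /andP[c'D /eqP rc'].
  have [_ _ ->] := repP _ _ rc; have [_ _ ->] := repP _ _ rc' => cc'.
  by move: rc'; rewrite -cc' rc => -[].
move=> A B sA sB dAB aA aB.
have /existsP[e /and3P[eAB we /setDP[cD c_new]]] := cov A B sA sB dAB aA aB.
have eW : e \in inner W by apply: (subsetP (between_sub_inner sA sB)).
have [e' rep_e] : exists e', rep (colour w e) = Some e'.
  by rewrite /rep; case: pickP => [e' _|/(_ e)]; [exists e' | rewrite eW we eqxx].
have [e'W we' e'c] := repP _ _ rep_e.
have : e' \in between A B.
  apply: contraR c_new => e'AB; apply/seenP; exists e' => //.
  by rewrite in_setD e'AB.
rewrite inE => /andP[_ /existsP[x /andP[xA /existsP[y /andP[yB /eqP e'E]]]]].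
exists x, y; split=> //=; apply/existsP; exists (colour w e).
by rewrite cD rep_e e'E eqxx.
Qed.

End Block.

Section CoveringProbability.
Variables (R : numFieldType) (G : sgraph) (K : finType) (p theta : R).
Variables (W : {set G}) (D : {set K}) (a b : nat).
Hypotheses (p_ge0 : 0 <= p) (p_le1 : p <= 1) (K_gt0 : (0 < #|K|)%N).
Hypothesis theta_le1 : theta <= 1.
Hypothesis theta_le : forall D' : {set K}, (#|D| < #|D'| + b)%N ->
  theta <= p * #|D'|%:R / #|K|%:R.
Local Notation Pr := (prob (@edge_law R G K p)).
Let law_ge0 := edge_law_ge0 (G := G) (K := K) p_ge0 p_le1.
Let law_sum := @sum_edge_law R G K p K_gt0.

(* Reveal first the edges inside W that do not join A to B: they use fewer than b
   colours, and each edge between A and B brings another colour of D with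
   probability at least theta. *)
Lemma prob_not_covers (A B : {set G}) : A \subset W -> B \subset W ->
  Pr (fun w => (#|present w (inner W)| < b)%N /\ ~~ covers w W D A B)
    <= (1 - theta) ^+ #|between A B|.
Proof.
move=> sA sB; apply: (prob_resample_le law_ge0 law_sum (A := ~: between A B)) => w.
set Q := seen w (inner W :\: between A B).
have seenE w' : seen (splice (~: between A B) w w') (inner W :\: between A B) = Q.
  by apply: eq_seen => e /setDP[_ eAB]; rewrite ffunE inE eAB.
have [bQ|Qb] := leqP b #|Q|.
  rewrite prob_false ?exprn_ge0 ?subr_ge0 // => w' [few _].
  move: bQ; rewrite leqNgt -(seenE w') (leq_ltn_trans _ few) //.
  by rewrite (leq_trans (card_seen _ _)) // subset_leq_card // presentS // subsetDl.
apply: le_trans (prob_avoid law_ge0 law_sum (L := between A B) (f := id)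
  (S := fun _ x => x.1 && (x.2 \in D :\: Q)) (theta := theta) _ _); last first.
- move=> e; rewrite inE => /andP[eG _]; rewrite edge_law_kept_in // theta_le //.
  by apply: leq_ltn_trans (leq_card_setD D Q) _; rewrite ltn_add2l.
- exact: in2W.
apply: (prob_le law_ge0) => w' [_ /existsPn none] e eAB; have := none e.
by rewrite eAB /= seenE ffunE inE eAB.
Qed.

Lemma prob_not_covering (c : R) : 0 <= c ->
  (forall A B : {set G}, [disjoint A & B] -> (a <= #|A|)%N -> (a <= #|B|)%N ->
    (1 - theta) ^+ #|between A B| <= c) ->
  Pr (fun w => (#|present w (inner W)| < b)%N /\ ~ covering a w W D)
    <= (2 ^ (#|W| + #|W|))%:R * c.
Proof.
move=> c_ge0 pair_le.
pose P (q : {set G} * {set G}) := [&& q.1 \subset W, q.2 \subset W,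
  [disjoint q.1 & q.2],
  (a <= #|q.1|)%N & (a <= #|q.2|)%N].
pose fails (q : {set G} * {set G}) (w : outcome G K) :=
  (#|present w (inner W)| < b)%N /\ ~~ covers w W D q.1 q.2.
apply: (@le_trans _ _ (Pr (fun w => exists2 q, P q & fails q w))).
  apply: (prob_le law_ge0) => w [few not_cov]; apply/not_exists2P => no_fail.
  apply: not_cov => A B sA sB dAB aA aB.
  have [|ok] := no_fail (A, B); first by rewrite /P sA sB dAB aA aB.
  by apply: contraT => not_covers; case: ok.
apply: (@le_trans _ _ (#|P|%:R * c)); last first.
  rewrite ler_wpM2r // ler_nat expnD -!card_powerset -cardsX.
  apply/subset_leq_card/subsetP=> -[A B] /and5P[/= sA sB _ _ _].
  by rewrite !inE /= sA sB.
apply: (prob_exists law_ge0) => -[A B] /and5P[/= sA sB dAB aA aB].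
exact: le_trans (prob_not_covers sA sB) (pair_le A B dAB aA aB).
Qed.

End CoveringProbability.

(** * Partial embeddings *)

Local Open Scope nat_scope.

Section Placement.
Variables (G : sgraph) (K T : finType) (S : rooted_tree T) (c : cutting S).
Variables (blk : G -> nat) (Bad : {set G}).
Implicit Types (w : outcome G K) (f phi : T -> G) (Z : {set G}) (D : {set K}).
Local Notation root := (tree_root S).
Local Notation pc := (piece_of c).
Local Notation top := (piece_top c).

Definition block (j : nat) : {set G} := [set x | blk x == j].
Definition below (j : nat) : {set {set G}} :=
  [set e : {set G} | e \subset [set x | blk x < j]].
Definition parent_edge f (v : T) : {set G} := [set f (parent S v); f v].
Definition attachment (i : nat) : T := parent S (top i).

Record placed (j : nat) w f : Prop := Placed {
  placed_block : forall v, pc v < j -> blk (f v) = pc v /\ f v \notin Bad;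
  placed_inj : forall v v', pc v < j -> pc v' < j -> f v = f v' -> v = v';
  placed_kept : forall v, pc v < j -> v != root -> kept w (parent_edge f v);
  placed_rainbow : forall v v', pc v < j -> pc v' < j -> v != root -> v' != root ->
    colour w (parent_edge f v) = colour w (parent_edge f v') -> v = v' }.

Record piece_copy (j : nat) w D Z phi : Prop := PieceCopy {
  piece_copy_in : forall v, v \in piece c j -> phi v \in block j :\: Z;
  piece_copy_inj : {in piece c j &, injective phi};
  piece_copy_edge : forall v, v \in piece c j -> v != top j ->
    [/\ parent_edge phi v \in inner (block j), kept w (parent_edge phi v)
      & colour w (parent_edge phi v) \in D];
  piece_copy_rainbow : forall v v', v \in piece c j -> v' \in piece c j ->
    v != top j -> v' != top j ->
    colour w (parent_edge phi v) = colour w (parent_edge phi v') -> v = v' }.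

Definition copy_roots (j : nat) w D Z : {set G} :=
  [set y | `[< exists2 phi, phi (top j) = y & piece_copy j w D Z phi >]].

Definition free_colours (j : nat) w f : {set K} :=
  ~: [set colour w (parent_edge f v) | v in [set v | (pc v < j) && (v != root)]].

Definition extend (j : nat) f phi (v : T) : G := if pc v == j then phi v else f v.

Record placements (j M : nat) w (F : nat -> T -> G) : Prop := Placements {
  placements_placed : forall k, k < M -> placed j w (F k);
  placements_attachment_inj : forall i k k', 0 < i <= pieces c ->
    pc (attachment i) < j -> k < M -> k' < M ->
    F k (attachment i) = F k' (attachment i) -> k = k' }.

Lemma parent_edge_inj (P : {set T}) f v v' : {in P &, injective f} ->
  v \in P -> v' \in P -> parent S v \in P -> parent S v' \in P ->
  v != root -> v' != root ->
  parent_edge f v = parent_edge f v' -> v = v'.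
Proof.
move=> f_inj vP v'P pvP pv'P vr v'r /set2_inj[[_ /f_inj->//]|[]].
move=> /(f_inj _ _ pvP v'P) pv /(f_inj _ _ vP pv'P) pv'.
have := depth_parent vr; have := depth_parent v'r.
by rewrite pv -pv' => /ltn_trans/[apply]; rewrite ltnn.
Qed.

Lemma placed_edge_below j w f v :
  placed j w f -> pc v < j -> parent_edge f v \in below j.
Proof.
move=> pl vj; have pj := leq_ltn_trans (piece_of_parent_le c v) vj.
rewrite inE subUset !sub1set !inE.
by have [-> _] := placed_block pl vj; have [-> _] := placed_block pl pj; rewrite vj pj.
Qed.

Lemma eq_placed j w w' f :
  (forall v, pc v < j -> v != root -> w (parent_edge f v) = w' (parent_edge f v)) ->
  placed j w f -> placed j w' f.
Proof.
move=> E pl; split; [exact: placed_block pl | exact: placed_inj pl |..].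
  by move=> v vj vr; rewrite -E // (placed_kept pl).
by move=> v v' vj v'j vr v'r; rewrite -!E //; apply: (placed_rainbow pl).
Qed.

Lemma eq_below_placed j w w' f : {in below j, w =1 w'} -> placed j w f -> placed j w' f.
Proof.
by move=> E pl; apply: eq_placed (pl) => v vj _; apply: E;
  apply: placed_edge_below pl vj.
Qed.

Lemma eq_placements j M w w' F : {in below j, w =1 w'} ->
  placements j M w F -> placements j M w' F.
Proof.
move=> E [plF injF]; split=> // k kM; exact: eq_below_placed E (plF k kM).
Qed.

Lemma eq_free_colours j w w' f : {in below j, w =1 w'} -> placed j w f ->
  free_colours j w' f = free_colours j w f.
Proof.
move=> E pl; congr (~: _); apply: eq_in_imset => v; rewrite inE => /andP[vj _].
by rewrite E // (placed_edge_below pl).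
Qed.

Lemma card_free_colours j w f : #|K| <= #|free_colours j w f| + #|T|.
Proof.
rewrite -(cardsC (free_colours j w f)) leq_add2l setCK.
by apply: leq_trans (leq_imset_card _ _) (max_card _).
Qed.

Lemma placed_not_free j w f v : pc v < j -> v != root ->
  colour w (parent_edge f v) \notin free_colours j w f.
Proof. by move=> vj vr; rewrite inE negbK; apply: imset_f; rewrite inE vj. Qed.

Lemma eq_piece_copy j w w' D Z phi : {in inner (block j), w =1 w'} ->
  piece_copy j w D Z phi -> piece_copy j w' D Z phi.
Proof.
move=> E [inZ inj edge rain]; split=> //.
  by move=> v vj vt; have [e_in ek ec] := edge v vj vt; rewrite -E.
move=> v v' vj v'j vt v't.
have [e_in _ _] := edge v vj vt; have [e'_in _ _] := edge v' v'j v't.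
by rewrite -!E //; apply: rain.
Qed.

Lemma extend_old j f phi v : pc v < j -> extend j f phi v = f v.
Proof. by move=> vj; rewrite /extend ltn_eqF. Qed.

Lemma extend_new j f phi v : pc v = j -> extend j f phi v = phi v.
Proof. by move=> vj; rewrite /extend vj eqxx. Qed.

Lemma parent_edge_extend_old j f phi v : pc v < j ->
  parent_edge (extend j f phi) v = parent_edge f v.
Proof.
move=> vj; have pj := leq_ltn_trans (piece_of_parent_le c v) vj.
by rewrite /parent_edge !extend_old.
Qed.

Lemma parent_edge_extend_top j f phi : 0 < j <= pieces c ->
  parent_edge (extend j f phi) (top j) = [set f (attachment j); phi (top j)].
Proof.
move=> js; rewrite /parent_edge (extend_new _ _ (piece_of_top js)).
by rewrite extend_old ?piece_of_parent_top.
Qed.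

Lemma parent_edge_extend_new j f phi v : 0 < j -> pc v = j -> v != top j ->
  parent_edge (extend j f phi) v = parent_edge phi v.
Proof.
by move=> j0 vj vt; rewrite /parent_edge !extend_new // piece_of_parent ?vj.
Qed.

Section Extend.
Variables (j : nat) (w : outcome G K) (f phi : T -> G) (Z : {set G}).
Hypothesis js : 0 < j <= pieces c.
Hypothesis f_placed : placed j w f.
Hypothesis phi_copy : piece_copy j w (free_colours j w f) Z phi.
Hypothesis BZ : Bad \subset Z.
Local Notation link := [set f (attachment j); phi (top j)].
Hypothesis link_kept : kept w link.
Hypothesis link_new :
  colour w link \in free_colours j w f :\: seen w (inner (block j)).
Local Notation f' := (extend j f phi).

Lemma extend_block v : pc v < j.+1 -> blk (f' v) = pc v /\ f' v \notin Bad.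
Proof.
rewrite ltnS leq_eqVlt => /orP[/eqP vj|vj].
  have /(piece_copy_in phi_copy)/setDP[] : v \in piece c j by rewrite mem_piece vj.
  rewrite inE extend_new // vj => /eqP-> vZ; split=> //.
  by apply: contra vZ; apply: (subsetP BZ).
by rewrite extend_old //; apply: (placed_block f_placed).
Qed.

Lemma extend_inj v v' : pc v < j.+1 -> pc v' < j.+1 -> f' v = f' v' -> v = v'.
Proof.
move=> vj v'j E; have pcE : pc v = pc v'.
  by have [<- _] := extend_block vj; have [<- _] := extend_block v'j; rewrite E.
move: vj v'j E; rewrite -pcE ltnS leq_eqVlt => /orP[/eqP vj _|vj _].
  by rewrite !extend_new -?pcE //; apply: (piece_copy_inj phi_copy);
    rewrite mem_piece -?pcE vj.
by rewrite !extend_old -?pcE //; apply: (placed_inj f_placed); rewrite -?pcE.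
Qed.

(* The edges of the embedding into blocks before j, the link, and the edges inside
   block j have colours in three disjoint classes. *)
Lemma extend_edge_cases v : pc v < j.+1 -> v != root ->
  let e := parent_edge f' v in kept w e /\
  [\/ [/\ pc v < j, e = parent_edge f v & (colour w e \in free_colours j w f) = false],
      [/\ v = top j, (colour w e \in free_colours j w f) = true
        & (colour w e \in seen w (inner (block j))) = false]
    | [/\ v \in piece c j, v != top j, e = parent_edge phi v,
          (colour w e \in free_colours j w f) = true
        & (colour w e \in seen w (inner (block j))) = true]].
Proof.
rewrite ltnS leq_eqVlt => /orP[/eqP vj|vj] vr /=; last first.
  rewrite parent_edge_extend_old // (placed_kept f_placed) //; split=> //.
  by constructor 1; rewrite (negPf (placed_not_free _ _ vj vr)).
have [->|vt] := eqVneq v (top j).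
  rewrite parent_edge_extend_top //; split=> //; constructor 2.
  by have /setDP[-> /negPf->] := link_new.
have vP : v \in piece c j by rewrite mem_piece vj.
have [e_in ek ec] := piece_copy_edge phi_copy vP vt.
rewrite parent_edge_extend_new //; last by case/andP: js.
split=> //; constructor 3; split=> //.
by apply/seenP; exists (parent_edge phi v).
Qed.

Lemma placed_extend : placed j.+1 w f'.
Proof.
split; [exact: extend_block | exact: extend_inj |..].
  by move=> v vj vr; case: (extend_edge_cases vj vr).
move=> v v' vj v'j vr v'r E.
have [_] := extend_edge_cases vj vr; have [_] := extend_edge_cases v'j v'r; rewrite -E.
move=> [[v'l eE' cf']|[v'E cf' cs']|[v'P v't eE' cf' cs']];
  move=> [[vl eE cf]|[vE cf cs]|[vP vt eE cf cs]]; try congruence.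
- by apply: (placed_rainbow f_placed); rewrite -?eE -?eE'.
- by apply: (piece_copy_rainbow phi_copy); rewrite -?eE -?eE'.
Qed.

End Extend.

Section CopyRoots.
Variables (d a j : nat) (w : outcome G K) (D : {set K}) (Z : {set G}).
Hypothesis js : 0 < j <= pieces c.
Hypothesis a_gt0 : 0 < a.
Hypothesis children_le : forall v, #|children S v| <= d.
Hypothesis cov : covering a w (block j) D.
Hypothesis room : #|piece c j| + (2 * d + 5) * a + #|Z| <= #|block j|.

Lemma copy_rootsP y :
  reflect (exists2 phi, phi (top j) = y & piece_copy j w D Z phi)
    (y \in copy_roots j w D Z).
Proof. by rewrite inE; apply: asboolP. Qed.

Lemma copy_roots_sub : copy_roots j w D Z \subset block j :\: Z.
Proof.
apply/subsetP=> y /copy_rootsP[phi <- /piece_copy_in]; apply.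
by rewrite mem_piece piece_of_top.
Qed.

Lemma piece_copy_of_embedding er phi : rainbow_rel w (block j) D er ->
  {in piece c j &, injective phi} ->
  (forall v, v \in piece c j -> phi v \in block j :\: Z) ->
  (forall v, v \in piece c j -> v != top j -> er (phi (parent S v)) (phi v)) ->
  piece_copy j w D Z phi.
Proof.
move=> rainbow phi_inj phi_in phi_edge; split=> // [v vP vt|v v' vP v'P vt v't].
  exact: (rainbow_rel_in rainbow (phi_edge v vP vt)).
have j0 : 0 < j by case/andP: js.
have not_root u : u \in piece c j -> u != root.
  by rewrite mem_piece; apply: contraTneq => ->; rewrite piece_of_root ltn_eqF.
have parent_in u : u \in piece c j -> u != top j -> parent S u \in piece c j.
  by rewrite !mem_piece => /eqP uj ut; rewrite piece_of_parent ?uj.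
move/(rainbow_rel_inj rainbow (phi_edge v vP vt) (phi_edge v' v'P v't)).
by apply: (parent_edge_inj phi_inj); rewrite ?not_root ?parent_in.
Qed.

Lemma card_copy_roots : #|block j :\: copy_roots j w D Z| <= a + #|Z|.
Proof.
have j0 : 0 < j by case/andP: js.
have [er rainbow er_joined] := covering_rainbow_joined cov.
have cardZ := leq_card_setD (block j) Z.
have [|Y [YZ Ya Y_exp]] :=
    joined_expanding (k := d.+1) a_gt0 (joinedS (subsetDl (block j) Z) er_joined).
  by move: room cardZ; lia.
have cardY : #|(block j :\: Z) :\: Y| + #|Y| = #|block j :\: Z|.
  by rewrite cardsDS // subnK // subset_leq_card.
have YR : Y \subset copy_roots j w D Z.
  apply/subsetP=> y yY; apply/copy_rootsP.
  have [||||phi [phiy phi_inj phi_in phi_edge]] :=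
      @tree_embedding _ _ er S (piece c j) (top j) d a Y a_gt0 _ _ _ Y_exp _ y yY.
  - by rewrite mem_piece piece_of_top.
  - move=> v; rewrite !mem_piece => /eqP vj vt; rewrite piece_of_parent ?vj //;
      split=> //.
    by apply: contraTneq j0 => vr; rewrite -vj vr piece_of_root.
  - by move=> v; apply: leq_trans (children_le v); rewrite subset_leq_card ?subsetDl.
  - by move: cardY Ya cardZ room; clear; lia.
  exists phi => //; apply: piece_copy_of_embedding rainbow phi_inj _ phi_edge => v vP.
  exact: (subsetP YZ) (phi_in v vP).
apply: leq_trans (_ : #|(block j :\: Z) :\: Y :|: Z| <= _); last first.
  by rewrite (leq_trans (leq_card_setU _ _)) // leq_add2r.
apply/subset_leq_card/subsetP=> x /setDP[xj xR]; rewrite in_setU !in_setD xj andbT.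
by rewrite (contra (subsetP YR x)) // orNb.
Qed.

End CopyRoots.

End Placement.

(** * Extending partial embeddings by one piece *)

Section Extensions.
Variables (G : sgraph) (K T : finType) (S : rooted_tree T) (c : cutting S).
Variables (blk : G -> nat) (Bad : {set G}) (a b : nat).
Variables (j M : nat) (F : nat -> T -> G).
Hypothesis js : 0 < j <= pieces c.
Implicit Types (w : outcome G K) (Z : {set G}).
Local Notation pc := (piece_of c).
Local Notation "'W_ j" := (block blk j) (at level 8, j at level 2, format "''W_' j").
Local Notation placed := (placed c blk Bad).
Local Notation placements := (placements c blk Bad).
Local Notation free := (free_colours c).

Definition source (k : nat) : G := F k (attachment c j).

(* Links are revealed embedding by embedding: when the first m embeddings have been
   dealt with, the links from the other ones to block j are still hidden. *)
Definition exposed (m : nat) : {set {set G}} :=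
  ~: [set e | [exists k : 'I_M, exists y in 'W_j,
                 (m <= k) && (e == [set source k; y])]].

Record ready w : Prop := Ready {
  ready_placements : placements j M w F;
  ready_covering : forall k, k < M -> covering a w 'W_j (free j w (F k));
  ready_few : #|present w (inner 'W_j)| < b }.

Record extensions (m g : nat) w (F' : nat -> T -> G) : Prop := Extensions {
  extensions_placements : placements j.+1 g w F';
  extensions_exposed : forall i v, i < g -> pc v < j.+1 -> v != tree_root S ->
    parent_edge S (F' i) v \in exposed m;
  extensions_of : forall i, i < g -> exists2 k, k < m &
    forall v, pc v < j -> F' i v = F k v }.

Definition occupied (g : nat) (F' : nat -> T -> G) : {set G} :=
  Bad :|: [set F' q.1 (attachment c q.2) | q : 'I_g * 'I_(pieces c).+1].

Definition fresh_colours w (k : nat) : {set K} :=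
  free j w (F k) :\: seen w (inner 'W_j).

Definition candidates (m B : nat) w Z : {set 'I_B * G} :=
  [set q : 'I_B * G | (q.2 \in copy_roots c blk j w (free j w (F (m + q.1))) Z)
           && adj (source (m + q.1)) q.2].

Definition link (m B : nat) (q : 'I_B * G) : {set G} := [set source (m + q.1); q.2].

Lemma exposedPn m e : reflect
  (exists k y, [/\ m <= k < M, y \in 'W_j & e = [set source k; y]])
  (e \notin exposed m).
Proof.
rewrite !inE negbK; apply: (iffP existsP) => [[k /existsP[y /and3P[yW mk /eqP eE]]]|].
  by exists k, y; rewrite mk ltn_ord.
case=> k [y [/andP[mk kM] yW ->]]; exists (Ordinal kM); apply/existsP; exists y.
by rewrite yW mk eqxx.
Qed.

Lemma below_exposed m : below blk j \subset exposed m.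
Proof.
apply/subsetP=> e; apply: contraTT => /exposedPn[k [y [_ + ->]]].
by rewrite inE => /eqP yj; rewrite inE subUset !sub1set !inE yj ltnn andbF.
Qed.

Lemma exposedS m m' : m <= m' -> exposed m \subset exposed m'.
Proof.
move=> mm'; apply/subsetP=> e; apply: contraTT
  => /exposedPn[k [y [/andP[m'k kM] yW ->]]].
by apply/exposedPn; exists k, y; rewrite (leq_trans mm').
Qed.

Lemma link_hidden m k y : m <= k < M -> y \in 'W_j ->
  [set source k; y] \notin exposed m.
Proof. by move=> mk yW; apply/exposedPn; exists k, y. Qed.

Lemma source_block w k : placements j M w F -> k < M ->
  blk (source k) < j /\ source k \notin Bad.
Proof.
move=> plF kM; have pj := piece_of_parent_top js.
by have [-> ?] := placed_block (placements_placed plF kM) pj.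
Qed.

Lemma source_inj w k k' : placements j M w F -> k < M -> k' < M ->
  source k = source k' -> k = k'.
Proof.
move=> plF kM k'M.
exact: (placements_attachment_inj plF js (piece_of_parent_top js) kM k'M).
Qed.

Lemma link_inj w k k' y y' : placements j M w F -> k < M -> k' < M ->
  y \in 'W_j -> y' \in 'W_j ->
  [set source k; y] = [set source k'; y'] -> k = k' /\ y = y'.
Proof.
move=> plF kM k'M yW y'W /set2_inj[[/(source_inj plF kM k'M)-> ->]//|[E _]].
by have [] := source_block plF kM; move: y'W; rewrite E inE => /eqP->; rewrite ltnn.
Qed.

Lemma inner_exposed w m : placements j M w F -> inner 'W_j \subset exposed m.
Proof.
move=> plF; apply/subsetP=> e; apply: contraTT => /exposedPn[k [y [/andP[_ kM] _ ->]]].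
have [xj _] := source_block plF kM.
by rewrite inE subUset !sub1set [source k \in _]inE (ltn_eqF xj) andbF.
Qed.

Lemma link_exposed w m k y : placements j M w F -> k < m -> k < M -> y \in 'W_j ->
  [set source k; y] \in exposed m.
Proof.
move=> plF km kM yW; apply: contraT => /exposedPn[k' [y' [/andP[mk' k'M] y'W]]].
case/(link_inj plF kM k'M yW y'W) => kk' _.
by rewrite kk' ltnNge mk' in km.
Qed.

Lemma eq_ready w w' : {in below blk j, w =1 w'} -> {in inner 'W_j, w =1 w'} ->
  ready w -> ready w'.
Proof.
move=> E_below E_inner [plF cov few]; split.
- exact: eq_placements E_below plF.
- move=> k kM; rewrite (eq_free_colours E_below (placements_placed plF kM)).
  exact: eq_covering E_inner (cov k kM).
- by rewrite -(eq_present E_inner).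
Qed.

Lemma eq_extensions m g w w' F' : {in exposed m, w =1 w'} ->
  extensions m g w F' -> extensions m g w' F'.
Proof.
move=> E [[plF' injF'] expF' extF']; split=> //; split=> // i ig.
by apply: eq_placed (plF' i ig) => v vj vr; apply: E; apply: expF'.
Qed.

Lemma extensions0 m w : extensions m 0 w F.
Proof. by []. Qed.

Lemma attachment_occupied g F' i i' : i < g -> 0 < i' <= pieces c ->
  F' i (attachment c i') \in occupied g F'.
Proof.
move=> ig /andP[_ i's]; apply/setUP; right; apply/imsetP.
by exists (Ordinal ig, Ordinal (i's : i' < (pieces c).+1)).
Qed.

Lemma card_occupied g F' : #|occupied g F'| <= #|Bad| + g * (pieces c).+1.
Proof.
apply: leq_trans (leq_card_setU _ _) _; rewrite leq_add2l.
by apply: leq_trans (leq_imset_card _ _) _; rewrite card_prod !card_ord.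
Qed.

Section AddExtension.
Variables (w : outcome G K) (m m' g k : nat) (F' : nat -> T -> G) (phi : T -> G).
Hypothesis plF : placements j M w F.
Hypothesis extF' : extensions m g w F'.
Hypothesis mk : m <= k < m'.
Hypothesis kM : k < M.
Hypothesis phi_copy : piece_copy c blk j w (free j w (F k)) (occupied g F') phi.
Local Notation new := (extend c j (F k) phi).
Hypothesis new_placed : placed j.+1 w new.

Lemma new_attachment_neq i i' : i < g -> 0 < i' <= pieces c ->
  pc (attachment c i') < j.+1 -> new (attachment c i') <> F' i (attachment c i').
Proof.
move=> ig i's; rewrite ltnS leq_eqVlt => /orP[/eqP pj|pj] E.
  have : attachment c i' \in piece c j by rewrite mem_piece pj.
  by move/(piece_copy_in phi_copy)/setDP=> [_];
    rewrite -(extend_new (F k) phi pj) E attachment_occupied.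
have [k' k'm kE] := extensions_of extF' ig.
have k'k : k' < k by apply: leq_trans k'm _; case/andP: mk.
have : k = k'.
  apply: (placements_attachment_inj plF i's pj kM (ltn_trans k'k kM)).
  by rewrite -kE // -E extend_old.
by move=> kk'; rewrite kk' ltnn in k'k.
Qed.

Lemma new_exposed v : pc v < j.+1 -> v != tree_root S ->
  parent_edge S new v \in exposed m'.
Proof.
rewrite ltnS leq_eqVlt => /orP[/eqP vj|vj] vr; last first.
  rewrite parent_edge_extend_old //; apply: (subsetP (below_exposed _)).
  exact: placed_edge_below (placements_placed plF kM) vj.
have vP : v \in piece c j by rewrite mem_piece vj.
have [->|vt] := eqVneq v (piece_top c j).
  rewrite parent_edge_extend_top //; apply: (link_exposed plF) => //;
    first by case/andP: mk.
  have /(piece_copy_in phi_copy)/setDP[] // : piece_top c j \in piece c j.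
  by rewrite mem_piece piece_of_top.
rewrite parent_edge_extend_new //; last by case/andP: js.
by apply: (subsetP (inner_exposed _ plF)); case: (piece_copy_edge phi_copy vP vt).
Qed.

Lemma extensions_add : extensions m' g.+1 w (fun i => if i == g then new else F' i).
Proof.
have mm' : m <= m' by case/andP: mk => mk' /ltnW; apply: leq_trans.
have lt_g i : i < g.+1 -> i != g -> i < g by rewrite ltnS leq_eqVlt => /orP[->|].
split; first split.
- move=> i ig; case: (eqVneq i g) => [_|/(lt_g _ ig)] //.
  exact: (placements_placed (extensions_placements extF')).
- move=> i i1 i2 i_s pj i1g i2g.
  case: (eqVneq i1 g) => [->|/(lt_g _ i1g) i1_lt];
    case: (eqVneq i2 g) => [->|/(lt_g _ i2g) i2_lt] //.
  + by move/new_attachment_neq; case.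
  + by move/esym/new_attachment_neq; case.
  + exact: (placements_attachment_inj (extensions_placements extF') i_s pj i1_lt i2_lt).
- move=> i v ig vj vr; case: (eqVneq i g) => [_|/(lt_g _ ig) i_lt];
    first exact: new_exposed.
  by apply: (subsetP (exposedS mm')); apply: (extensions_exposed extF').
- move=> i ig; case: (eqVneq i g) => [_|/(lt_g _ ig) i_lt].
    by exists k; [case/andP: mk | move=> v vj; rewrite extend_old].
  by have [k' k'm kE] := extensions_of extF' i_lt; exists k' => //;
    apply: leq_trans k'm mm'.
Qed.

End AddExtension.

Lemma link_extends (w w1 : outcome G K) m g B F' (q : 'I_B * G) :
  ready w -> extensions m g w F' -> m + B <= M -> {in exposed m, w =1 w1} ->
  q \in candidates m B w (occupied g F') ->
  kept w1 (link m q) -> colour w1 (link m q) \in fresh_colours w (m + q.1) ->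
  exists F'', extensions (m + B) g.+1 w1 F''.
Proof.
move=> rw extF' mB E; rewrite inE => /andP[/copy_rootsP[phi phiq phi_copy] _] lk lc.
set k := m + q.1 in phi_copy lc.
have kM : k < M by apply: leq_trans mB; rewrite ltn_add2l.
have plF := ready_placements rw; have plFk := placements_placed plF kM.
have E_below : {in below blk j, w =1 w1} by move=> e /(subsetP (below_exposed m));
  apply: E.
have E_inner : {in inner 'W_j, w =1 w1} by move=> e /(subsetP (inner_exposed m plF));
  apply: E.
have phi_copy1 : piece_copy c blk j w1 (free j w1 (F k)) (occupied g F') phi.
  by rewrite (eq_free_colours E_below plFk); apply: eq_piece_copy E_inner phi_copy.
have linkE : [set F k (attachment c j); phi (piece_top c j)] = link m q by rewrite phiq.
exists (fun i => if i == g then extend c j (F k) phi else F' i).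
apply: (@extensions_add w1 m) => //.
- exact: eq_placements E_below plF.
- exact: eq_extensions E extF'.
- by rewrite leq_addr ltn_add2l /=.
apply: placed_extend phi_copy1 _ _ _ => //; rewrite ?linkE //.
- exact: eq_below_placed E_below plFk.
- exact: subsetUl.
- by rewrite (eq_free_colours E_below plFk) -(eq_seen E_inner).
Qed.

End Extensions.

Local Open Scope ring_scope.

Section Step.
Variables (R : numFieldType) (G : sgraph) (K T : finType) (p theta : R).
Variables (S : rooted_tree T) (c : cutting S) (blk : G -> nat) (Bad : {set G}).
Variables (d a b : nat).
Hypotheses (p_ge0 : 0 <= p) (p_le1 : p <= 1) (K_gt0 : (0 < #|K|)%N).
Hypotheses (theta_ge0 : 0 <= theta) (theta_le1 : theta <= 1).
Hypotheses (d_gt0 : (0 < d)%N) (a_gt0 : (0 < a)%N).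
Hypothesis children_le : forall v, (#|children S v| <= d)%N.
Hypothesis theta_le : forall D : {set K}, (#|K| <= #|D| + #|T| + b)%N ->
  theta <= p * #|D|%:R / #|K|%:R.
Hypothesis theta_half : (1 - theta) ^+ a <= 2^-1.
Local Notation "'W_ j" := (block blk j) (at level 8, j at level 2, format "''W_' j").
Hypothesis block_degree : forall x j, (0 < j <= pieces c)%N -> blk x != j ->
  x \notin Bad -> (#|'W_j| <= 3 * #|[set y in 'W_j | adj x y]|)%N.
Hypothesis block_room : forall j, (0 < j <= pieces c)%N ->
  (#|piece c j| + (2 * d + 8) * a <= #|'W_j|)%N.
Hypothesis few_inner : forall j, (0 < j <= pieces c)%N ->
  (1 + p) ^+ #|inner 'W_j| / 2 ^+ b <= 2^-1 ^+ a.
Hypothesis many_between : forall j, (0 < j <= pieces c)%N ->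
  forall A A' : {set G}, [disjoint A & A'] -> (a <= #|A|)%N -> (a <= #|A'|)%N ->
  (1 - theta) ^+ #|between A A'| <= 2^-1 ^+ (3 * #|'W_j|).

Local Notation Pr := (prob (@edge_law R G K p)).
Local Notation free := (free_colours c).
Local Notation placements := (placements c blk Bad).
Let law_ge0 := edge_law_ge0 (G := G) (K := K) p_ge0 p_le1.
Let law_sum := @sum_edge_law R G K p K_gt0.
Let half_ge0 m : 0 <= (2^-1 : R) ^+ m. Proof. by rewrite exprn_ge0 ?invr_ge0. Qed.
Implicit Types (w : outcome G K) (Z : {set G}).

Section Batch.
Variables (j M : nat) (F : nat -> T -> G).
Hypothesis js : (0 < j <= pieces c)%N.
Local Notation ready := (ready c blk Bad a b j M F).
Local Notation extensions := (extensions c blk Bad j M F).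
Local Notation exposed := (exposed c blk j M F).
Local Notation occupied := (occupied c Bad).
Local Notation candidates := (candidates c blk j F).
Local Notation link := (link c j F).
Local Notation fresh_colours := (fresh_colours c blk j F).

Lemma card_candidates m B w Z : ready w -> (m + B <= M)%N -> (#|Z| <= a)%N ->
  (B * a <= #|candidates m B w Z|)%N.
Proof.
move=> [plF cov _] mB Za.
pose Y (i : 'I_B) := copy_roots c blk j w (free j w (F (m + i)%N)) Z.
pose N (i : 'I_B) := [set y in Y i | adj (source c j F (m + i)%N) y].
have -> : #|candidates m B w Z| = (\sum_(i < B) #|N i|)%N.
  rewrite -sum1dep_card (eq_bigr (fun i => \sum_(y in N i) 1)%N); last first.
    by move=> i _; rewrite sum1_card.
  by rewrite pair_big_dep; apply: eq_bigl => q; rewrite [in RHS]inE.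
rewrite -[X in (X * a)%N]card_ord -sum_nat_const; apply: leq_sum => i _.
have iM : (m + i < M)%N by rewrite (leq_trans _ mB) // ltn_add2l.
have [xj xB] := source_block js plF iM.
have := block_degree js (negbT (ltn_eqF xj)) xB; have := block_room js.
have : (#|'W_j :\: Y i| <= a + #|Z|)%N.
  apply: (card_copy_roots js a_gt0 children_le (cov _ iM)).
  by apply: leq_trans (block_room js); move: Za; clear; lia.
set A := [set y in 'W_j | adj _ y].
have : (#|A| <= #|N i| + #|'W_j :\: Y i|)%N.
  apply: leq_trans (leq_card_setU _ _); apply/subset_leq_card/subsetP=> y.
  rewrite inE => /andP[yW axy].
  by rewrite in_setU in_setD yW [y \in N i]inE axy; case: (y \in Y i).
by move: Za d_gt0; clear; nia.
Qed.

Lemma card_fresh_colours w k : ready w -> (#|K| <= #|fresh_colours w k| + #|T| + b)%N.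
Proof.
move=> rw; apply: leq_trans (card_free_colours c j w (F k)) _.
rewrite addnAC leq_add2r; apply: leq_trans (leq_card_setD _ (seen w (inner 'W_j))) _.
rewrite leq_add2l; exact: leq_trans (card_seen _ _) (ltnW (ready_few rw)).
Qed.

Lemma prob_no_link m B w Z : ready w -> (m + B <= M)%N -> (#|Z| <= a)%N ->
  Pr (fun w' => forall q, q \in candidates m B w Z ->
        ~~ (kept w' (link m q) && (colour w' (link m q) \in fresh_colours w (m + q.1)%N)))
    <= 2^-1 ^+ B.
Proof.
move=> rw mB Za; have plF := ready_placements rw.
have idx (i : 'I_B) : (m + i < M)%N by rewrite (leq_trans _ mB) // ltn_add2l.
apply: (le_trans (prob_avoid law_ge0 law_sum (L := candidates m B w Z)
  (f := fun q => link m q)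
  (S := fun q x => x.1 && (x.2 \in fresh_colours w (m + q.1)%N)) (theta := theta) _ _)).
- move=> [i y] [i' y'].
  rewrite inE => /andP[/(subsetP (copy_roots_sub _ _ _ _ js))/setDP[yW _] _].
  rewrite inE => /andP[/(subsetP (copy_roots_sub _ _ _ _ js))/setDP[y'W _] _].
  case/(link_inj js plF (idx i) (idx i') yW y'W) => /= /eqP;
    rewrite eqn_add2l => /eqP ii' ->.
  by congr pair; apply: val_inj.
- move=> q; rewrite inE => /andP[_ adj_q].
  by rewrite edge_law_kept_in ?theta_le ?card_fresh_colours // mem_edges.
apply: (@le_trans _ _ ((1 - theta) ^+ (B * a))).
  by rewrite ler_wiXn2l ?subr_ge0 ?gerBl // card_candidates.
by rewrite mulnC exprM lerXn2r // nnegrE ?exprn_ge0 ?subr_ge0 ?invr_ge0.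
Qed.

Definition batch_state (m g : nat) w : Prop :=
  ready w /\ exists F', extensions m g w F'.

Lemma batch_step m g B w : (m + B <= M)%N -> (#|Bad| + g * (pieces c).+1 <= a)%N ->
  batch_state m g w ->
  Pr (fun w' => ~ batch_state (m + B)%N g.+1 (splice (exposed m) w w')) <= 2^-1 ^+ B.
Proof.
move=> mB few [rw [F' extF']]; have plF := ready_placements rw.
have Za : (#|occupied g F'| <= a)%N := leq_trans (card_occupied _ _ _ _) few.
apply: le_trans (prob_no_link rw mB Za); apply: (prob_le law_ge0) => w'.
set w1 := splice _ _ _ => fails q q_in; apply/negP=> /andP[lk lc]; apply: fails.
have E : {in exposed m, w =1 w1} by move=> e e_exposed; rewrite ffunE e_exposed.
split.
  apply: eq_ready rw => e eb; apply: E; first exact: (subsetP (below_exposed _ _ _ _ _ _)).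
  exact: (subsetP (inner_exposed js _ plF)).
have link_w1 : w1 (link m q) = w' (link m q).
  rewrite ffunE ifN // link_hidden ?leq_addr //= ?(leq_trans _ mB) ?ltn_add2l //.
  by move: q_in; rewrite inE => /andP[/(subsetP (copy_roots_sub _ _ _ _ js))/setDP[]].
by apply: (link_extends js rw extF' mB E q_in); rewrite link_w1.
Qed.

Lemma batch_steps N B w0 g : M = (N * B)%N -> (#|Bad| + N * (pieces c).+1 <= a)%N ->
  (g <= N)%N ->
  Pr (fun w => batch_state 0 0 (splice (below blk j) w0 w)) - g%:R * 2^-1 ^+ B
    <= Pr (fun w => batch_state (g * B)%N g (splice (below blk j) w0 w)).
Proof.
move=> ME few; elim: g => [|g IH] gN; first by rewrite mul0r subr0.
rewrite -natr1 mulrDl mul1r opprD addrA.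
apply: le_trans (lerB (IH (ltnW gN)) (lexx _)) _.
apply: (prob_resample_ge law_ge0 law_sum (A := exposed (g * B)%N)) => // w st.
have gB : (g * B + B <= M)%N by rewrite ME addnC -mulSn leq_mul2r gN orbT.
have few_g : (#|Bad| + g * (pieces c).+1 <= a)%N.
  by apply: leq_trans few; rewrite leq_add2l leq_mul2r ltnW ?orbT.
apply: le_trans (batch_step gB few_g st); apply: (prob_le law_ge0) => w'.
have -> : splice (below blk j) w0 (splice (exposed (g * B)%N) w w')
        = splice (exposed (g * B)%N) (splice (below blk j) w0 w) w'.
  apply/ffunP=> e; rewrite !ffunE; case eb: (e \in below blk j) => //.
  by rewrite (subsetP (below_exposed _ _ _ _ _ _) _ eb).
by rewrite mulSn addnC.
Qed.

Lemma prob_not_ready w0 : placements j M w0 F ->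
  Pr (fun w => ~ ready (splice (below blk j) w0 w)) <= M.+1%:R * 2^-1 ^+ a.
Proof.
move=> plF; pose D (k : 'I_M) := free j w0 (F k).
have E_below w : {in below blk j, w0 =1 splice (below blk j) w0 w}.
  by move=> e eb; rewrite ffunE eb.
have E_inner w : {in inner 'W_j, w =1 splice (below blk j) w0 w}.
  move=> e; rewrite inE ffunE => /andP[eG eW]; rewrite ifN // inE; apply/negP=> eb.
  move: eG eW eb; rewrite inE => /existsP[x /existsP[y /andP[_ /eqP->]]].
  by rewrite !subUset !sub1set !inE => /andP[/eqP-> _] /andP[]; rewrite ltnn.
apply: (@le_trans _ _ (Pr (fun w => (b <= #|present w (inner 'W_j)|)%N \/
    exists2 k : 'I_M, true &
      (#|present w (inner 'W_j)| < b)%N /\ ~ covering a w 'W_j (D k)))).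
  apply: (prob_le law_ge0) => w not_ready; apply: contrapT => /not_orP[/negP].
  rewrite -ltnNge => few no_fail; apply: not_ready; split.
  - exact: eq_placements (E_below w) plF.
  - move=> k kM; have plFk := placements_placed plF kM.
    rewrite (eq_free_colours (E_below w) plFk); apply: (eq_covering (E_inner w)).
    by apply: contrapT => not_cov; apply: no_fail; exists (Ordinal kM).
  - by rewrite -(eq_present (E_inner w)).
apply: le_trans (prob_or law_ge0 _ _) _; rewrite -natr1 mulrDl mul1r addrC.
apply: lerD; last first.
  apply: le_trans (few_inner js); apply: (prob_count_ge law_ge0 law_sum
    (S := fun _ x => x.1)).
  by move=> e; rewrite inE => /andP[eG _]; rewrite edge_law_kept.
have -> : M%:R = #|(fun _ : 'I_M => true)|%:R :> R by rewrite card_ord.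
apply: (prob_exists law_ge0) => k _.
apply: (@le_trans _ _ ((2 ^ (#|'W_j| + #|'W_j|))%:R * 2^-1 ^+ (3 * #|'W_j|))).
  apply: (prob_not_covering _ p_ge0 p_le1 K_gt0 theta_le1 _ (half_ge0 _)
    (many_between js)).
  move=> D' lt; apply: theta_le; have := card_free_colours c j w0 (F k).
  by move: lt; rewrite /D; clear; lia.
have -> : (3 * #|'W_j| = (#|'W_j| + #|'W_j|) + #|'W_j|)%N by lia.
rewrite exprD mulrA natrX exprVn divff ?mul1r; last by rewrite expf_neq0 // pnatr_eq0.
rewrite ler_wiXn2l ?invr_ge0 ?invf_le1 ?ler1n //.
by have := block_room js; move: d_gt0; clear; nia.
Qed.

End Batch.

Lemma piece_step j N B : (0 < j <= pieces c)%N -> (#|Bad| + N * (pieces c).+1 <= a)%N ->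
  Pr (fun w => exists F, placements j (N * B)%N w F)
      - ((N * B).+1%:R * 2^-1 ^+ a + N%:R * 2^-1 ^+ B)
    <= Pr (fun w => exists F, placements j.+1 N w F).
Proof.
move=> js few; apply: (prob_resample_ge law_ge0 law_sum (A := below blk j)).
  by rewrite addr_ge0 // mulr_ge0.
move=> w0 [F plF].
pose state m g w := batch_state j (N * B)%N F m g (splice (below blk j) w0 w).
apply: (@le_trans _ _ (Pr (fun w => ~ state (N * B)%N N w))).
  apply: (prob_le law_ge0) => w none [_ [F' /extensions_placements plF']].
  by apply: none; exists F'.
rewrite prob_not // lerBlDr -lerBlDl opprD addrA.
apply: le_trans (batch_steps F js w0 erefl few (leqnn N)); rewrite lerD2r.
apply: (@le_trans _ _
  (Pr (fun w => ready c blk Bad a b j (N * B)%N F (splice (below blk j) w0 w)))).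
  by have := prob_not_ready js plF; rewrite prob_not // lerBlDr -lerBlDl.
by apply: (prob_le law_ge0) => w rw; split=> //; exists F; apply: extensions0.
Qed.

(* N embeddings are extended out of N batches of N + m: a batch fails with probability
   at most 2^-(N + m), hence some batch fails with probability at most 2^-m. *)
Fixpoint embedding_count (m i : nat) : nat :=
  if i is i'.+1 then embedding_count m i' * (embedding_count m i' + m) else 1.

Lemma embedding_count_gt0 m i : (0 < embedding_count m i)%N.
Proof. by elim: i => //= i IH; rewrite muln_gt0 IH ltn_addr. Qed.

Lemma leq_embedding_count m i i' : (i <= i')%N ->
  (embedding_count m i <= embedding_count m i')%N.
Proof.
elim: i' => [|i' IH]; first by rewrite leqn0 => /eqP->.
rewrite leq_eqVlt => /orP[/eqP->//|/IH le] /=.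
by apply: leq_trans le _; rewrite leq_pmulr // ltn_addr // embedding_count_gt0.
Qed.

Section Pieces.
Variable m : nat.
Hypothesis trunk_root : piece c 0 = [set tree_root S].
Hypothesis initial : (embedding_count m (pieces c) <= #|'W_0 :\: Bad|)%N.
Hypothesis few : (#|Bad| + embedding_count m (pieces c) * (pieces c).+1 <= a)%N.

Lemma initial_placements N w : (0 < N)%N -> (N <= #|'W_0 :\: Bad|)%N ->
  exists F, placements 1 N w F.
Proof.
move=> N0 le; have /card_gt0P[x0 _] := leq_trans N0 le.
pose z k := nth x0 (enum ('W_0 :\: Bad)) k.
have z_in k : (k < N)%N -> z k \in 'W_0 :\: Bad.
  by move=> kN; rewrite -mem_enum mem_nth // -cardE (leq_trans kN).
have in_trunk v : (piece_of c v < 1)%N -> v = tree_root S.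
  by rewrite ltnS leqn0 -mem_piece trunk_root => /set1P.
exists (fun k _ => z k); split=> [k kN|i k k' _ _ kN k'N /eqP].
  split.
  - move=> v v0; have := z_in k kN; rewrite in_setD inE => /andP[-> /eqP->].
    by move: v0; rewrite ltnS leqn0 => /eqP->.
  - by move=> v v' /in_trunk-> /in_trunk->.
  - by move=> v /in_trunk->; rewrite eqxx.
  - by move=> v v' /in_trunk-> /in_trunk->.
by rewrite nth_uniq ?enum_uniq -?cardE ?(leq_trans kN) ?(leq_trans k'N) // => /eqP.
Qed.

Lemma prob_pieces_placed j : (j <= pieces c)%N ->
  1 - j%:R * ((embedding_count m (pieces c)).+1%:R * 2^-1 ^+ a + 2^-1 ^+ m)
    <= Pr (fun w => exists F, placements j.+1 (embedding_count m (pieces c - j)%N) w F).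
Proof.
elim: j => [|j IH] js.
  rewrite mul0r subr0 subn0 prob_true // => w.
  exact: initial_placements (embedding_count_gt0 _ _) initial.
set N := embedding_count m (pieces c - j.+1).
have NE : (N * (N + m) = embedding_count m (pieces c - j))%N by rewrite -(subnSK js).
have few_N : (#|Bad| + N * (pieces c).+1 <= a)%N.
  apply: leq_trans few; rewrite leq_add2l leq_mul2r.
  by rewrite leq_embedding_count ?leq_subr ?orbT.
apply: le_trans (piece_step (j := j.+1) (N + m) js few_N).
rewrite NE -natr1 mulrDl mul1r opprD addrA; apply: lerB; first exact: IH (ltnW js).
apply: lerD.
  by rewrite ler_wpM2r // ler_nat ltnS leq_embedding_count // leq_subr.
rewrite exprD mulrA -[leRHS]mul1r ler_wpM2r // exprVn ler_pdivrMr ?exprn_gt0 //.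
by rewrite mul1r -natrX ler_nat ltnW // ltn_expl.
Qed.

End Pieces.

End Step.

Lemma placed_rainbow_copy (G T : sgraph) (K : finType) (S : rooted_tree T) (c : cutting S)
    (blk : G -> nat) (Bad : {set G}) (w : outcome G K) (f : T -> G) :
  (forall x y : T, adj x y = (x \in children S y) || (y \in children S x)) ->
  placed c blk Bad (pieces c).+1 w f ->
  has_rainbow_copy T [set e | kept w e] [ffun e => colour w e].
Proof.
move=> adjE pl; have all_placed v : (piece_of c v < (pieces c).+1)%N.
  by rewrite ltnS piece_of_le.
have copy_edgeP e : e \in copy_edges [ffun v => f v] ->
    exists2 v, v != tree_root S & e = parent_edge S f v.
  case/imsetP=> e0; rewrite inE => /existsP[x /existsP[y /andP[axy /eqP->]]] ->.
  rewrite imsetU1 imset_set1 !ffunE; move: axy; rewrite adjE !inE.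
  by case/orP=> /andP[vr /eqP<-]; [exists x; rewrite // /parent_edge setUC | exists y].
apply/existsP; exists [ffun v => f v]; apply/and3P; split.
- by apply/injectiveP=> u v; rewrite !ffunE; apply: (placed_inj pl).
- by apply/subsetP=> e /copy_edgeP[v vr ->]; rewrite inE (placed_kept pl).
apply/forallP=> e1; apply/implyP=> /copy_edgeP[v1 v1r ->].
apply/forallP=> e2; apply/implyP=> /copy_edgeP[v2 v2r ->].
apply/implyP; rewrite !ffunE => /eqP E; apply/eqP.
by rewrite (placed_rainbow pl (all_placed v1) (all_placed v2) v1r v2r E).
Qed.

(** * Pseudorandom graphs *)

Local Open Scope nat_scope.

Lemma subset_of_card (V : finType) (U : {set V}) k : k <= #|U| ->
  exists2 A : {set V}, A \subset U & #|A| = k.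
Proof.
case/card_geqP=> s [s_uniq <- sU]; exists [set x in s].
  by apply/subsetP=> x; rewrite inE => /sU.
by rewrite cardsE (card_uniqP s_uniq).
Qed.

Lemma disjoint_blocks (V : finType) (U : {set V}) (s : nat) (sz : nat -> nat) :
  \sum_(j < s) sz j <= #|U| ->
  exists blk : V -> nat, forall j, j < s -> #|[set x in U | blk x == j]| = sz j.
Proof.
elim: s U sz => [|s IH] U sz; first by exists (fun=> 0).
rewrite big_ord_recl => szU.
have [A AU cA] := subset_of_card (leq_trans (leq_addr _ _) szU).
have [|blk blkE] := IH (U :\: A) (fun j => sz j.+1).
  by rewrite cardsDS // cA leq_subRL // (leq_trans _ szU) ?leq_addr.
exists (fun x => if x \in A then 0 else (blk x).+1) => -[|j] js.
  rewrite -cA; apply: eq_card => x; rewrite inE.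
  by case: ifP => xA; rewrite ?andbF // (subsetP AU).
rewrite -blkE //; apply: eq_card => x; rewrite !inE.
by case: (x \in A); rewrite ?andbF.
Qed.

Definition low_degree (G : sgraph) (W : {set G}) : {set G} :=
  [set x | (x \notin W) && (3 * #|[set y in W | adj x y]| < #|W|)].

Lemma edges_between_le (G : sgraph) (A B : {set G}) :
  edges_between A B <= \sum_(x in A) #|[set y in B | adj x y]|.
Proof.
apply: (@leq_trans #|\bigcup_(x in A) [set [set x; y] | y in [set y in B | adj x y]]|).
  apply/subset_leq_card/subsetP=> e; rewrite inE => /andP[eG].
  case/existsP=> x /andP[xA /existsP[y /andP[yB /eqP eE]]].
  apply/bigcupP; exists x => //; apply/imsetP; exists y => //.
  by rewrite inE yB -mem_edges -eE.
apply: leq_trans (leq_card_bigcup _ _) _; apply: leq_sum => x _.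
exact: leq_imset_card.
Qed.

Lemma card_low_degree (G : sgraph) (W : {set G}) : 0 < #|G| -> pseudorandom G ->
  #|low_degree W| * #|W| < 250 * #|G|.
Proof.
move=> G_gt0 psr; rewrite ltnNge; apply/negP=> big.
have disj : [disjoint low_degree W & W].
  by apply/pred0P=> x /=; rewrite !inE; case: (x \in W); rewrite ?andbF.
have := psr _ _ disj big; have := edges_between_le (low_degree W) W.
have : 3 * \sum_(x in low_degree W) #|[set y in W | adj x y]| + #|low_degree W|
    <= #|low_degree W| * #|W|.
  rewrite big_distrr /= -[X in _ + X]sum1_card -big_split /= -sum_nat_const.
  by apply: leq_sum => x; rewrite inE addn1 => /andP[].
have : 0 < #|low_degree W|.
  by rewrite lt0n; apply: contraTneq big => ->; rewrite -ltnNge; lia.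
lia.
Qed.

(** * Powers close to 1 *)

Local Open Scope ring_scope.

Section Powers.
Variable R : realFieldType.
Implicit Types (x : R) (n : nat).

Lemma bernoulli_ineq x n : -1 <= x -> 1 + n%:R * x <= (1 + x) ^+ n.
Proof.
move=> x_ge; elim: n => [|n IH]; first by rewrite mul0r addr0 expr0.
have x1_ge0 : 0 <= 1 + x by lra.
rewrite exprS; apply: le_trans (ler_wpM2l x1_ge0 IH).
by rewrite -natr1; have := mulr_ge0 (ler0n R n) (sqr_ge0 x); rewrite expr2; nra.
Qed.

Lemma expr_1B_1D_le1 x n : 0 <= x -> x <= 1 -> (1 - x) ^+ n * (1 + x) ^+ n <= 1.
Proof.
move=> x0 x1; rewrite -exprMn -subr_sqr expr1n exprn_ile1 ?gerBl ?sqr_ge0 //.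
by rewrite subr_ge0 exprn_ile1.
Qed.

Lemma expr_1B_le_half x n : 0 <= x -> x <= 1 -> 1 <= n%:R * x -> (1 - x) ^+ n <= 2^-1.
Proof.
move=> x0 x1 nx; rewrite -[leRHS]mul1r ler_pdivlMr //.
apply: le_trans (expr_1B_1D_le1 n x0 x1); rewrite ler_wpM2l ?exprn_ge0 ?subr_ge0 //.
by apply: le_trans (bernoulli_ineq n _); lra.
Qed.

Lemma expr_1D_le_two x n : 0 <= x -> x <= 1 -> n%:R * x <= 2^-1 -> (1 + x) ^+ n <= 2.
Proof.
move=> x0 x1 nx.
have half_le : 2^-1 <= (1 - x) ^+ n.
  by apply: le_trans (bernoulli_ineq n _); rewrite ?mulrN; lra.
have := expr_1B_1D_le1 n x0 x1; rewrite mulrC -ler_pdivlMr; last first.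
  by apply: lt_le_trans half_le; rewrite invr_gt0.
rewrite mul1r => /le_trans; apply.
by rewrite invf_ple ?posrE // (lt_le_trans _ half_le) ?invr_gt0.
Qed.

End Powers.

Lemma geometric_half_small (R : archiRealFieldType) (x del : R) : 0 < del ->
  exists M, forall n, (M <= n)%N -> x * 2^-1 ^+ n <= del.
Proof.
move=> del_gt0; exists (Num.Def.archi_bound (x / del)) => n /upper_nthrootP/ltW.
by rewrite exprVn ler_pdivrMr // ler_pdivrMr ?exprn_gt0 // mulrC.
Qed.

(** * Choice of the parameters *)

Local Open Scope nat_scope.

Lemma divn_half m n : 0 < m -> m <= n -> n <= 2 * m * (n %/ m).
Proof.
move=> m_gt0 mn; have : 0 < n %/ m by rewrite divn_gt0.
by have := ltn_ceil n m_gt0; nia.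
Qed.

Section Constants.
Variables h d k n : nat.
Hypothesis h_gt0 : 0 < h.

(* The tree leaves a proportion 1 / h of the vertices unused.  It is cut into at most
   3k pieces of at most d n / k vertices, and C lies between [density * k] and
   [2 * density * k].  A block then carries O(n / k) edges, few compared with the
   n / h unused colours, while two sets of [expansion_size] vertices have more edges
   between them than the union bound over all pairs of subsets of a block requires. *)
Definition slack := 4 * h * (2 * d + 8).
Definition density := 144 * (slack * slack) * h * (d + 1).
Definition least_pieces := 64 * h * density * ((d + 1) * (d + 1)) + d.
Definition expansion_size := n %/ (k * slack).
Definition piece_size := n %/ k.
Definition edge_limit := n %/ (2 * h).

(* With p = C / n and theta = p / 2h, the number of factors that bring a power of
   1 - theta below 1 / 2, respectively that keep a power of 1 + p below 2. *)
Definition half_exponent := (2 * h * n) %/ (density * k) + 1.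
Definition double_exponent := n %/ (4 * density * k).

Lemma slack_ge : 8 * h <= slack.
Proof. by rewrite /slack; nia. Qed.

Lemma slack_gt0 : 0 < slack.
Proof. by have := slack_ge; lia. Qed.

Lemma density_ge : 8 * h * slack <= density.
Proof.
rewrite /density -[leqRHS]mulnA; have := leq_mul (leqnn (slack * slack)) h_gt0.
have : slack <= slack * slack := leq_pmulr _ slack_gt0.
by move: (slack * slack) => slack2; nia.
Qed.

Lemma density_gt0 : 0 < density.
Proof. by apply: leq_trans density_ge; rewrite muln_gt0 slack_gt0 muln_gt0 h_gt0. Qed.

Lemma least_pieces_gt0 : 0 < least_pieces.
Proof. by have := density_gt0; rewrite /least_pieces; nia. Qed.

Hypothesis k_big : least_pieces <= k.

Let k_gt0 : 0 < k.
Proof. exact: leq_trans least_pieces_gt0 k_big. Qed.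

Lemma density_k_gt0 : 0 < density * k.
Proof. by rewrite muln_gt0 density_gt0 k_gt0. Qed.

Lemma k_slack_gt0 : 0 < k * slack.
Proof. by rewrite muln_gt0 k_gt0 slack_gt0. Qed.

Hypothesis n_big : 4 * density * k <= n.

Lemma k_slack_le : k * slack <= n.
Proof.
apply: leq_trans n_big; rewrite mulnC leq_mul2r; apply/orP; right.
by have := density_ge; nia.
Qed.

Let k_le : k <= n.
Proof. by apply: leq_trans k_slack_le; rewrite leq_pmulr ?slack_gt0. Qed.

Lemma order_gt0 : 0 < n.
Proof. exact: leq_trans k_slack_gt0 k_slack_le. Qed.

Lemma expansion_size_le : k * slack * expansion_size <= n.
Proof. by rewrite mulnC leq_divM. Qed.

Lemma expansion_size_ge : n <= 2 * (k * slack) * expansion_size.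
Proof. exact: divn_half k_slack_gt0 k_slack_le. Qed.

Lemma expansion_size_gt0 : 0 < expansion_size.
Proof. by rewrite divn_gt0 ?k_slack_gt0 // k_slack_le. Qed.

Lemma piece_size_le : k * piece_size <= n.
Proof. by rewrite mulnC leq_divM. Qed.

Lemma piece_size_ge : n <= 2 * k * piece_size.
Proof. exact: divn_half k_gt0 k_le. Qed.

Lemma piece_size_gt0 : 0 < piece_size.
Proof. by rewrite divn_gt0 ?k_gt0 // k_le. Qed.

Lemma piece_number_le s N : N <= n -> s * piece_size <= N + piece_size * d ->
  s <= 3 * k.
Proof.
move=> Nn le; rewrite -(leq_pmul2r piece_size_gt0) (leq_trans le) //.
have : d <= k by apply: leq_trans k_big; apply: leq_addl.
by have := piece_size_ge; move: piece_size => t; nia.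
Qed.

Lemma blocks_fit s N : h * N + n <= h * n -> s <= 3 * k ->
  N + s.+1 * ((2 * d + 8) * expansion_size) <= n.
Proof.
move=> Nn s3; rewrite -(leq_pmul2l h_gt0) mulnDr.
apply: leq_trans Nn; rewrite leq_add2l; apply: leq_trans expansion_size_le.
have s4 : s.+1 <= 4 * k by have := k_gt0; lia.
rewrite (_ : h * _ = s.+1 * (h * (2 * d + 8) * expansion_size)); last by lia.
rewrite (_ : k * slack * _ = 4 * k * (h * (2 * d + 8) * expansion_size)).
  by rewrite leq_mul2r s4 orbT.
by rewrite /slack; lia.
Qed.

Lemma block_size_le P W : P <= d * piece_size -> W = P + (2 * d + 8) * expansion_size ->
  k * W <= (d + 1) * n.
Proof.
move=> Pt ->; rewrite mulnDr [leqRHS]mulnDl mul1n leq_add //.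
  by have := piece_size_le; move: piece_size Pt => t; nia.
apply: leq_trans expansion_size_le; rewrite mulnA leq_mul2r; apply/orP; right.
by rewrite leq_mul2l /slack; apply/orP; right; nia.
Qed.

Lemma exceptional_size_le :
  (3 * k).+1 * (250 * n) <= 2000 * (k * k) * slack * expansion_size.
Proof.
apply: (@leq_trans (1000 * k * n)).
  by rewrite mulnA leq_mul2r; have := k_gt0; lia.
rewrite (_ : 2000 * _ * _ * _ = 1000 * k * (2 * (k * slack) * expansion_size)).
  by rewrite leq_mul2l expansion_size_ge orbT.
by lia.
Qed.

Lemma expansion_size_square : 2000 * (k * k) * slack <= expansion_size ->
  250 * n <= expansion_size * expansion_size.
Proof.
move=> a_big; apply: leq_trans (leq_mul (leqnn 250) expansion_size_ge) _.
rewrite mulnA leq_mul2r (leq_trans _ a_big) ?orbT //.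
by have := k_gt0; move: slack => g; nia.
Qed.

Lemma half_exponent_ge : 2 * h * n <= density * k * half_exponent.
Proof. by rewrite /half_exponent addn1 [leqRHS]mulnC ltnW // ltn_ceil ?density_k_gt0. Qed.

Lemma half_exponent_le : density * k * half_exponent <= 4 * h * n.
Proof.
have := leq_divM (2 * h * n) (density * k).
rewrite /half_exponent mulnDr muln1 [X in _ <= _ -> X + _ <= _]mulnC.
have : density * k <= h * n.
  by apply: leq_trans (leq_pmull _ h_gt0); apply: leq_trans n_big; nia.
by lia.
Qed.

Lemma half_exponent_le_size : half_exponent <= expansion_size.
Proof.
rewrite -(leq_pmul2l density_k_gt0); apply: leq_trans half_exponent_le _.
apply: leq_trans (leq_mul (leqnn (4 * h)) expansion_size_ge) _.
rewrite (_ : 4 * h * _ = 8 * h * slack * (k * expansion_size)); last by lia.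
by rewrite -[leqRHS]mulnA leq_mul2r density_ge orbT.
Qed.

Lemma half_exponent_square W : k * W <= (d + 1) * n ->
  3 * (half_exponent * (3 * W)) <= expansion_size * expansion_size.
Proof.
move=> kW; pose unit_size := 2 * (k * slack).
have scale_gt0 : 0 < density * (unit_size * unit_size).
  by rewrite muln_gt0 density_gt0 muln_gt0 [0 < unit_size]muln_gt0 k_slack_gt0.
rewrite -(leq_pmul2l scale_gt0); apply: (@leq_trans (density * (n * n))); last first.
  have := leq_mul (leqnn density) (leq_mul expansion_size_ge expansion_size_ge).
  by move/leq_trans; apply; rewrite mulnACA mulnA.
rewrite (_ : density * _ * _ =
  36 * (slack * slack) * (density * k * half_exponent * (k * W))).
  apply: leq_trans (leq_mul (leqnn _) (leq_mul half_exponent_le kW)) _.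
  by rewrite [density in leqRHS]/density; apply: eq_leq; lia.
by rewrite /unit_size; lia.
Qed.

Lemma double_exponent_le : 4 * density * k * double_exponent <= n.
Proof. by rewrite mulnC leq_divM. Qed.

Lemma double_exponent_ge : n <= 2 * (4 * density * k) * double_exponent.
Proof. by apply: divn_half n_big; rewrite -mulnA muln_gt0 density_k_gt0. Qed.

Definition inner_exponent := (8 * density * ((d + 1) * (d + 1)) * n) %/ k + 1.

Lemma inner_exponent_ge : 8 * density * ((d + 1) * (d + 1)) * n <= k * inner_exponent.
Proof.
by rewrite /inner_exponent [_ %/ k + 1]addn1 [leqRHS]mulnC ltnW // ltn_ceil ?k_gt0.
Qed.

Lemma inner_exponent_le : 8 * h * inner_exponent <= n + 8 * h.
Proof.
rewrite mulnDr muln1 leq_add2r -(leq_pmul2l k_gt0).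
have := leq_divM (8 * density * ((d + 1) * (d + 1)) * n) k; set q := _ %/ k => kq.
rewrite (_ : k * _ = 8 * h * (q * k)); last by lia.
apply: leq_trans (leq_mul (leqnn _) kq) _.
apply: leq_trans (leq_mul k_big (leqnn n)); rewrite /least_pieces [(_ + d) * n]mulnDl.
by apply: leq_trans (leq_addr _ _); apply: eq_leq; lia.
Qed.

Lemma block_square_le W : k * W <= (d + 1) * n ->
  W * W <= double_exponent * inner_exponent.
Proof.
move=> kW; have kk_gt0 : 0 < k * k by rewrite muln_gt0 k_gt0.
rewrite -(leq_pmul2l kk_gt0) mulnACA; apply: leq_trans (leq_mul kW kW) _.
rewrite mulnACA mulnA.
apply: leq_trans (leq_mul (leqnn ((d + 1) * (d + 1) * n)) double_exponent_ge) _.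
rewrite (_ : _ * _ * n * _ =
  k * double_exponent * (8 * density * ((d + 1) * (d + 1)) * n)).
  apply: leq_trans (leq_mul (leqnn _) inner_exponent_ge) _.
  by apply: eq_leq; rewrite mulnACA.
by lia.
Qed.

Lemma edge_limit_ge : inner_exponent + expansion_size <= edge_limit.
Proof.
have n_ge : 8 * h <= n.
  by apply: leq_trans k_slack_le; have := slack_ge; have := k_gt0; nia.
have size_le : 8 * h * expansion_size <= n.
  apply: leq_trans expansion_size_le; rewrite leq_mul2r; apply/orP; right.
  by apply: leq_trans slack_ge _; rewrite leq_pmull ?k_gt0.
have limit_ge : n < edge_limit.+1 * (2 * h) by rewrite ltn_ceil // muln_gt0.
have := inner_exponent_le; move: size_le limit_ge h_gt0 n_ge.
move: inner_exponent expansion_size edge_limit => q a b; clear.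
by nia.
Qed.

End Constants.

(** * The probability bound *)

Local Open Scope ring_scope.

Section RainbowTree.
Variables (R : realType) (h d k m n : nat) (C : R) (T G : sgraph).
Variables (S : rooted_tree T) (c : cutting S) (blk : G -> nat).
Hypotheses (h_gt0 : (0 < h)%N) (d_gt0 : (0 < d)%N).
Hypotheses (k_big : (least_pieces h d <= k)%N) (n_big : (4 * density h d * k <= n)%N).
Hypotheses (C_ge : (density h d * k)%:R <= C) (C_le : C <= (2 * density h d * k)%:R).
Local Notation a := (expansion_size h d k n).
Hypothesis a_big :
  (2000 * (k * k) * slack h d + embedding_count m (3 * k) * (3 * k).+1 <= a)%N.
Hypotheses (card_G : #|G| = n) (psr : pseudorandom G).
Hypothesis T_small : (h * #|T| + n <= h * n)%N.
Hypothesis adjE : forall x y : T,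
  adj x y = (x \in children S y) || (y \in children S x).
Hypothesis children_le : forall v, (#|children S v| <= d)%N.
Hypothesis trunk_root : piece c 0 = [set tree_root S].
Hypothesis pieces_le : (pieces c <= 3 * k)%N.
Hypothesis card_piece : forall j, (0 < j <= pieces c)%N ->
  (#|piece c j| <= d * piece_size k n)%N.
Hypothesis card_block : forall j, (j <= pieces c)%N ->
  #|block blk j| = (#|piece c j| + (2 * d + 8) * a)%N.

Let p : R := C / n%:R.
Let theta : R := p / (2 * h)%:R.
Let Bad : {set G} := \bigcup_(j < (pieces c).+1 | (0 < j)%N) low_degree (block blk j).

Let a_gt0 : (0 < a)%N. Proof. exact: expansion_size_gt0. Qed.
Let nR_gt0 : 0 < n%:R :> R. Proof. by rewrite ltr0n (order_gt0 h_gt0 k_big n_big). Qed.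
Let hR_gt0 : 0 < (2 * h)%:R :> R. Proof. by rewrite ltr0n muln_gt0. Qed.
Let p_ge0 : 0 <= p. Proof. by rewrite divr_ge0 // (le_trans _ C_ge). Qed.
Let theta_ge0 : 0 <= theta. Proof. by rewrite divr_ge0. Qed.

Let p_le1 : p <= 1.
Proof.
rewrite ler_pdivrMr // mul1r (le_trans C_le) // ler_nat (leq_trans _ n_big) //.
by rewrite -!mulnA leq_mul2r orbT.
Qed.

Let theta_le1 : theta <= 1.
Proof. by rewrite ler_pdivrMr // mul1r (le_trans p_le1) // ler1n muln_gt0. Qed.

Lemma theta_le_unused (D : {set 'I_n}) : (#|'I_n| <= #|D| + #|T| + edge_limit h n)%N ->
  theta <= p * #|D|%:R / #|'I_n|%:R.
Proof.
rewrite card_ord => D_big; rewrite -mulrA ler_wpM2l // ler_pdivlMr // mulrC.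
rewrite ler_pdivrMr // -natrM ler_nat.
have : (edge_limit h n * (2 * h) <= n)%N by apply: leq_divM.
by move: (edge_limit h n) D_big T_small h_gt0; clear => b; nia.
Qed.

Lemma theta_power_le_half z : (half_exponent h d k n <= z)%N ->
  (1 - theta) ^+ z <= 2^-1.
Proof.
move=> z_ge; apply: (@le_trans _ _ ((1 - theta) ^+ half_exponent h d k n)).
  by rewrite ler_wiXn2l ?subr_ge0 ?theta_le1 // gerBl.
apply: expr_1B_le_half => //.
rewrite !mulrA ler_pdivlMr // ler_pdivlMr // mul1r.
apply: le_trans (ler_wpM2l (ler0n _ _) C_ge).
by rewrite -!natrM ler_nat [leqRHS]mulnC half_exponent_ge.
Qed.

Lemma block_room j : (j <= pieces c)%N ->
  (#|piece c j| + (2 * d + 8) * a <= #|block blk j|)%N.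
Proof. by move=> /card_block->. Qed.

Lemma k_card_block_le j : (0 < j <= pieces c)%N ->
  (k * #|block blk j| <= (d + 1) * n)%N.
Proof.
move=> js; apply: (block_size_le h_gt0 k_big n_big (card_piece js)).
by apply: card_block; case/andP: js.
Qed.

Lemma card_Bad : (#|Bad| <= 2000 * (k * k) * slack h d)%N.
Proof.
rewrite -(leq_pmul2r a_gt0).
apply: leq_trans (exceptional_size_le h_gt0 k_big n_big).
apply: (@leq_trans
  (\sum_(j < (pieces c).+1 | (0 < j)%N) #|low_degree (block blk j)| * a)).
  by rewrite -big_distrl /= leq_mul2r leq_card_bigcup orbT.
apply: (@leq_trans (\sum_(j < (pieces c).+1) 250 * n)); last first.
  by rewrite sum_nat_const card_ord leq_mul2r ltnS pieces_le orbT.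
rewrite big_mkcond; apply: leq_sum => j _; case: ifP => // j_gt0.
have G_gt0 : (0 < #|G|)%N by rewrite card_G (order_gt0 h_gt0 k_big n_big).
have := card_low_degree (block blk j) G_gt0 psr; rewrite card_G => /ltnW.
apply: leq_trans.
rewrite leq_mul2l (leq_trans _ (block_room (leq_ord j))) ?orbT //.
by rewrite (leq_trans _ (leq_addl _ _)) // leq_pmull // addn_gt0 orbT.
Qed.

Lemma block_degree x j : (0 < j <= pieces c)%N -> blk x != j -> x \notin Bad ->
  (#|block blk j| <= 3 * #|[set y in block blk j | adj x y]|)%N.
Proof.
move=> /andP[j_gt0 js] xj; rewrite leqNgt; apply: contra => few; apply/bigcupP.
by exists (Ordinal (js : (j < (pieces c).+1)%N)); rewrite // inE few inE xj.
Qed.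

Lemma embeddings_fit :
  (#|Bad| + embedding_count m (pieces c) * (pieces c).+1 <= a)%N.
Proof.
apply: leq_trans a_big; rewrite leq_add ?card_Bad // leq_mul //.
exact: leq_embedding_count.
Qed.

Lemma first_block_big : (embedding_count m (pieces c) <= #|block blk 0 :\: Bad|)%N.
Proof.
have := block_room (leq0n _); have := embeddings_fit.
have := leq_card_setD (block blk 0) Bad; move: a_gt0; clear.
by move: #|Bad| (embedding_count _ _) => bad count; nia.
Qed.

Lemma many_edges_between j : (0 < j <= pieces c)%N -> forall A A' : {set G},
  [disjoint A & A'] -> (a <= #|A|)%N -> (a <= #|A'|)%N ->
  (1 - theta) ^+ #|between A A'| <= 2^-1 ^+ (3 * #|block blk j|).
Proof.
move=> js A A' disj aA aA'; have aa : (a * a <= #|A| * #|A'|)%N := leq_mul aA aA'.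
have AA' : (#|A| * #|A'| <= 3 * #|between A A'|)%N.
  apply: psr => //; rewrite card_G; apply: leq_trans aa.
  apply: (expansion_size_square h_gt0 k_big n_big).
  exact: leq_trans (leq_addr _ _) a_big.
have := half_exponent_square h_gt0 k_big n_big (k_card_block_le js).
move=> /leq_trans/(_ (leq_trans aa AA')); rewrite leq_pmul2l // => many.
apply: (@le_trans _ _ ((1 - theta) ^+ (half_exponent h d k n * (3 * #|block blk j|)))).
  by rewrite ler_wiXn2l ?subr_ge0 ?theta_le1 // gerBl.
rewrite exprM lerXn2r ?nnegrE ?exprn_ge0 ?invr_ge0 ?subr_ge0 ?theta_le1 //.
exact: theta_power_le_half.
Qed.

Lemma few_edges_inside j : (0 < j <= pieces c)%N ->
  (1 + p) ^+ #|inner (block blk j)| / 2 ^+ edge_limit h n <= 2^-1 ^+ a.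
Proof.
move=> js; pose q := inner_exponent h d k n; pose y := double_exponent h d k n.
have p1 : 1 <= 1 + p by rewrite lerDl.
have y2 : (1 + p) ^+ y <= 2.
  apply: expr_1D_le_two => //.
  rewrite mulrA ler_pdivrMr //; apply: le_trans (ler_wpM2l (ler0n _ _) C_le) _.
  rewrite [leRHS]mulrC ler_pdivlMr // -!natrM ler_nat.
  by have := double_exponent_le h d k n; rewrite -/y; clear; lia.
have inner_le : (#|inner (block blk j)| <= y * q)%N.
  apply: leq_trans (card_inner _) _.
  exact: (block_square_le h_gt0 k_big n_big (k_card_block_le js)).
rewrite ler_pdivrMr ?exprn_gt0 //; apply: (@le_trans _ _ (2 ^+ q)).
  apply: le_trans (ler_weXn2l p1 inner_le) _.
  by rewrite exprM lerXn2r // nnegrE ?exprn_ge0 ?(le_trans _ p1).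
rewrite exprVn mulrC ler_pdivlMr ?exprn_gt0 // -exprD ler_weXn2l ?ler1n //.
exact: edge_limit_ge.
Qed.

Lemma prob_rainbow_copy_blocks :
  1 - (3 * k)%:R * ((embedding_count m (3 * k)).+1%:R * 2^-1 ^+ a + 2^-1 ^+ m)
    <= coloured_Gp_prob (G := G) (K := 'I_n) p (fun H col => has_rainbow_copy T H col).
Proof.
have K_gt0 : (0 < #|'I_n|)%N by rewrite card_ord -(ltr_nat R).
have half_ge0 i : 0 <= (2^-1 : R) ^+ i by rewrite exprn_ge0 ?invr_ge0.
have theta_half := theta_power_le_half (half_exponent_le_size h_gt0 k_big n_big).
have room j (js : (0 < j <= pieces c)%N) := block_room (proj2 (andP js)).
have all_placed := prob_pieces_placed p_ge0 p_le1 K_gt0 theta_ge0 theta_le1 d_gt0 a_gt0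
  children_le theta_le_unused theta_half block_degree room few_edges_inside
  many_edges_between trunk_root first_block_big embeddings_fit (leqnn _).
rewrite coloured_Gp_probE; apply: le_trans (le_trans all_placed _).
  rewrite lerB // ler_pM ?ler_nat ?addr_ge0 ?mulr_ge0 //.
  by rewrite lerD2r ler_wpM2r // ler_nat ltnS leq_embedding_count.
apply: prob_le => [e x|w [F]]; first exact: edge_law_ge0 p_ge0 p_le1 e x.
rewrite subnn => plF; apply: placed_rainbow_copy adjE _.
exact: (placements_placed plF (ltn0Sn 0)).
Qed.

End RainbowTree.

Lemma prob_rainbow_copy (R : realType) (h d k m n : nat) (C : R) (T G : sgraph) :
  (0 < h)%N -> (0 < d)%N -> (least_pieces h d <= k)%N -> (4 * density h d * k <= n)%N ->
  (density h d * k)%:R <= C -> C <= (2 * density h d * k)%:R ->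
  (2000 * (k * k) * slack h d + embedding_count m (3 * k) * (3 * k).+1
    <= expansion_size h d k n)%N ->
  is_tree T -> (h * #|T| + n <= h * n)%N -> max_degree T = d ->
  #|G| = n -> pseudorandom G ->
  1 - (3 * k)%:R * ((embedding_count m (3 * k)).+1%:R * 2^-1 ^+ expansion_size h d k n
                    + 2^-1 ^+ m)
    <= coloured_Gp_prob (G := G) (K := 'I_n) (C / n%:R)
         (fun H col => has_rainbow_copy T H col).
Proof.
move=> h_gt0 d_gt0 k_big n_big C_ge C_le a_big treeT T_small dT card_G psr.
have [S adjE] := tree_rooting treeT.
have children_le v : (#|children S v| <= d)%N.
  rewrite -dT; apply: leq_trans (leq_bigmax v); apply/subset_leq_card/subsetP=> u uv.
  by rewrite inE adjE uv orbT.
have t_gt0 := piece_size_gt0 h_gt0 k_big n_big.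
have [c [trunk_root card_piece pieces_few]] := cutting_exists children_le d_gt0 t_gt0.
have pieces_le : (pieces c <= 3 * k)%N.
  apply: (piece_number_le h_gt0 k_big n_big _ pieces_few).
  by move: T_small h_gt0; clear; nia.
pose sz j := (#|piece c j| + (2 * d + 8) * expansion_size h d k n)%N.
have [|blk card_blk] := @disjoint_blocks G setT (pieces c).+1 sz.
  rewrite cardsT card_G big_split /= sum_card_piece sum_nat_const card_ord.
  exact: blocks_fit.
apply: (prob_rainbow_copy_blocks h_gt0 d_gt0 k_big n_big C_ge C_le a_big card_G psr
  T_small adjE children_le trunk_root pieces_le card_piece (blk := blk)) => j js.
by rewrite -[RHS]card_blk //; apply: eq_card => x; rewrite !inE.
Qed.

Lemma prob_rainbow_copy_limit (R : realType) (h d k : nat) (C delta : R) :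
  (0 < h)%N -> (0 < d)%N -> (least_pieces h d <= k)%N ->
  (density h d * k)%:R <= C -> C <= (2 * density h d * k)%:R -> 0 < delta ->
  exists N : nat, forall n : nat, (N <= n)%N ->
    forall T : sgraph, is_tree T -> (h * #|T| + n <= h * n)%N -> max_degree T = d ->
    forall G : sgraph, #|G| = n -> pseudorandom G ->
    1 - delta <= coloured_Gp_prob (G := G) (K := 'I_n) (C / n%:R)
      (fun H col => has_rainbow_copy T H col).
Proof.
move=> h_gt0 d_gt0 k_big C_ge C_le delta_gt0.
have half_gt0 : 0 < delta / 2 by rewrite divr_gt0.
have [m m_ok] := geometric_half_small (3 * k)%:R half_gt0.
pose count := embedding_count m (3 * k).
have [M M_ok] := geometric_half_small ((3 * k)%:R * count.+1%:R) half_gt0.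
pose A := (2000 * (k * k) * slack h d + count * (3 * k).+1 + M)%N.
exists (4 * density h d * k + A * (k * slack h d))%N
  => n nN T treeT T_small dT G card_G psr.
have n_big : (4 * density h d * k <= n)%N := leq_trans (leq_addr _ _) nN.
have A_le : (A <= expansion_size h d k n)%N.
  rewrite /expansion_size leq_divRL; first exact: leq_trans (leq_addl _ _) nN.
  exact: k_slack_gt0.
apply: le_trans (prob_rainbow_copy h_gt0 d_gt0 k_big n_big C_ge C_le
  (leq_trans (leq_addr _ _) A_le) treeT T_small dT card_G psr).
rewrite lerB // [leRHS](splitr delta) mulrDr mulrA lerD ?m_ok // M_ok //.
exact: leq_trans (leq_addl _ _) A_le.
Qed.

Lemma natural_multiple_between (R : archiRealFieldType) (L k0 : nat) (C : R) :
  (0 < L)%N -> (0 < k0)%N -> (L * k0)%:R <= C ->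
  exists k, [/\ (k0 <= k)%N, (L * k)%:R <= C & C <= (2 * L * k)%:R].
Proof.
move=> L_gt0 k0_gt0 C_ge; have LR : 0 < L%:R :> R by rewrite ltr0n.
have CL_ge0 : 0 <= C / L%:R by rewrite divr_ge0 // (le_trans _ C_ge).
exists (Num.truncn (C / L%:R)).
have k0_le : (k0 <= Num.truncn (C / L%:R))%N.
  by rewrite truncn_ge_nat // ler_pdivlMr // -natrM mulnC.
have /andP[kC] := truncn_itv CL_ge0; rewrite ltr_pdivrMr // => /ltW Ck.
split=> //; first by rewrite mulnC natrM -ler_pdivlMr.
apply: le_trans Ck _; rewrite -natrM ler_nat.
by move: (Num.truncn _) k0_le => k; nia.
Qed.

Theorem theorem3p2 (R : realType) (eps : R) (d : nat)
    (eps_gt0 : 0 < eps) (eps_lt1 : eps < 1) (d_ge2 : (2 <= d)%N) :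
  exists C0 : R, forall C : R, C0 <= C ->
    forall delta : R, 0 < delta ->
    exists N : nat, forall n : nat, (N <= n)%N ->
    forall T : sgraph, is_tree T -> #|T|%:R <= (1 - eps) * n%:R ->
      max_degree T = d ->
    forall G : sgraph, #|G| = n -> pseudorandom G ->
    1 - delta <=
      coloured_Gp_prob (G := G) (K := 'I_n) (C / n%:R)
        (fun H c => has_rainbow_copy T H c).
Proof.
have d_gt0 : (0 < d)%N := ltnW d_ge2.
pose h := Num.Def.archi_bound eps^-1.
have h_eps : 1 <= h%:R * eps.
  by rewrite -ler_pdivrMr // mul1r; apply/ltW/archi_boundP; rewrite invr_ge0 ltW.
have h_gt0 : (0 < h)%N.
  by rewrite lt0n; apply: contraTneq h_eps => ->; rewrite mul0r -ltNge ltr01.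
exists (density h d * least_pieces h d)%:R => C C_ge delta delta_gt0.
have [k [k_big kC Ck]] := natural_multiple_between (density_gt0 d h_gt0)
  (least_pieces_gt0 d h_gt0) C_ge.
have [N tree_copy] := prob_rainbow_copy_limit h_gt0 d_gt0 k_big kC Ck delta_gt0.
exists N => n nN T treeT T_small dT G; apply: (tree_copy n nN T treeT _ dT G).
rewrite -(ler_nat R) natrD !natrM.
have := ler_wpM2l (ler0n R h) T_small; have := ler_wpM2r (ler0n R n) h_eps.
by move: (h%:R : R) (n%:R : R) (#|T|%:R : R) => x y z; lra.
Qed.
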